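(* Let $\gamma$ be a strong composition. Then $$G_{\gamma}(X;0,t) = \sum_{\tau\in\mathrm{ST}_{1}(\gamma)} (1-t)^{\omega(\tau)} (-t)^{|\mathrm{Des}(\tau)|} t^{\mathrm{coinv}(\tau)-\mathrm{coinv}(\mathrm{Des}(\tau))} F_{\widehat{V}(\tau)}.$$
   Context: Compositions and diagrams. A strong composition $\gamma=(\gamma_1,\dots,\gamma_\ell)$ of $n=|\gamma|=\sum_i\gamma_i$ is a finite list of positive integers. $\mathrm{inc}(\gamma)$ is the list obtained by sorting the parts of $\gamma$ in weakly increasing order. $\beta(\gamma)$ is the permutation $\sigma\in S_\ell$ of greatest length (number of inversions of its one-line word) with $\gamma_{\sigma_j}=\mathrm{inc}(\gamma)_j$ for all $j$; i.e. its one-line word lists the positions of the parts of $\gamma$ in weakly increasing order of part size, positions of equal parts being listed in decreasing order. For a composition $\alpha$, the diagram $\mathrm{dg}(\alpha)$ has $\alpha_i$ cells in column $i$ (columns numbered left to right, bottom-justified, rows numbered from bottom to top starting at 1); cell $(r,c)$ is in row $r$, column $c$. All tableaux attached to $\gamma$ are fillings of $\mathrm{dg}(\mathrm{inc}(\gamma))$, and $\widehat{\mathrm{dg}}(\gamma)$ denotes the set of cells of $\mathrm{dg}(\mathrm{inc}(\gamma))$ not in the bottom row; $h(\gamma)=n-\ell$ is the number of cells in $\widehat{\mathrm{dg}}(\gamma)$. A filling $T$ assigns a positive integer $T(u)$ to every cell $u$; $x^T=\prod_u x_{T(u)}$. $\mathrm{South}(u)$ is the cell directly below $u$. Statistics.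 In the diagram of $\alpha=\mathrm{inc}(\gamma)$: $\mathrm{leg}(u)$ is the number of cells above $u$ in its column; for $u=(r,i)$, the arm of $u$ consists of the cells $(r,j)\in\mathrm{dg}(\alpha)$ with $j>i$, $\alpha_j\le\alpha_i$ and the cells $(r-1,j)\in\mathrm{dg}(\alpha)$ with $j<i$, $\alpha_j<\alpha_i$, and $\mathrm{arm}(u)$ is its cardinality. $\mathrm{Des}(T)=\{u\in\widehat{\mathrm{dg}}(\gamma): T(u)>T(\mathrm{South}(u))\}$ (its elements are called descents) and $\mathrm{maj}(T)=\sum_{u\in\mathrm{Des}(T)}(\mathrm{leg}(u)+1)$. A triple consists of a cell $x\in\widehat{\mathrm{dg}}(\gamma)$, the cell $y=\mathrm{South}(x)$, and a cell $z$ in the arm of $x$ (type A if $z$ is in the row of $x$, type B if $z$ is in the row of $y$). It is a coinversion triple if the entries strictly increase cyclically clockwise (type A) or counterclockwise (type B); in both types this means $T(x)<T(z)<T(y)$ or $T(z)<T(y)<T(x)$ or $T(y)<T(x)<T(z)$. $\mathrm{coinv}(T)$ is the number of coinversion triples. Non-attacking fillings and $G_\gamma$. Two distinct cells attack each other if they are in the same row, or if they are in adjacent rows and the one in the upper row is in a column strictly to the right of the one in the lower row. $T$ is non-attacking if $T(u)\ne T(v)$ for all attacking pairs $u,v$. $\mathrm{NAT}(\gamma)$ is the set of non-attacking fillings of $\mathrm{dg}(\mathrm{inc}(\gamma))$ whose bottom row, read left to right, is order-equivalent to $\beta(\gamma)$. For $T\in\mathrm{NAT}(\gamma)$, $$\mathrm{wt}(T)=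 q^{\mathrm{maj}(T)}t^{\mathrm{coinv}(T)} \prod_{\substack{u \in \widehat{\mathrm{dg}}(\gamma)\\ T(u) \neq T(\mathrm{South}(u))}} \frac{1-t}{1-q^{\mathrm{leg}(u)+1}t^{\mathrm{arm}(u)+1}}.$$ The quasisymmetric Macdonald polynomial is the formal power series in $X=\{x_1,x_2,\dots\}$ given by $G_\gamma(X;q,t)=\sum_{T\in\mathrm{NAT}(\gamma)}\mathrm{wt}(T)\,x^T$, and $G_\gamma(X;0,t)$ is its specialization at $q=0$ (so only fillings with $\mathrm{Des}(T)=\emptyset$ contribute). Standard fillings. $\mathrm{ST}(\gamma)$ is the set of fillings $\tau$ of $\mathrm{dg}(\mathrm{inc}(\gamma))$ using each of $1,\dots,n$ exactly once, whose bottom row, read left to right, is order-equivalent to $\beta(\gamma)$. Cells of $\tau$ are identified with their entries. $\mathrm{ST}_1(\gamma)$ is the set of $\tau\in\mathrm{ST}(\gamma)$ such that whenever the cell with entry $i$ is a descent, the entry directly below it is $i-1$. For $\tau\in\mathrm{ST}_1(\gamma)$: - $\mathrm{coinv}(\mathrm{Des}(\tau)):=\sum_{u\in\mathrm{Des}(\tau)}\mathrm{arm}(u)$; - $\omega(\tau):=h(\gamma)-|\{i\in[n-1]: i\text{ and }i+1\text{ are in the same column of }\tau\}|$; - $\mathrm{ID}(\tau)$ is the set of $i\in[n-1]$ such that $i+1$ precedes $i$ in reading order (rows from top to bottom, left to right within each row); - the descent group of $i$ is the maximal connected (vertically contiguous) set of cells in the column of $i$, containing $i$, in which every cell is a descent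 except the bottom cell of the set, which is not a descent (so each cell lies in exactly one descent group); - $i$ attacks $i+1$ through descents if some cell of the descent group of $i$ and some cell of the descent group of $i+1$ attack each other; - $\widehat V(\tau)$ is the set of $i\in[n-1]$ such that $i\in\mathrm{ID}(\tau)$ or $i$ attacks $i+1$ through descents. Fundamental quasisymmetric functions. For $S\subseteq[n-1]$, $F_S=\sum x_{i_1}x_{i_2}\cdots x_{i_n}$, the sum over all $1\le i_1\le i_2\le\cdots\le i_n$ such that $i_j\ne i_{j+1}$ whenever $j\in S$. *)

(* Defs.v *)
From HB Require Import structures.
From mathcomp Require Import all_boot all_order all_fingroup all_algebra.
From mathcomp Require Import generic_quotient.
From mathcomp Require Import finmap multiset.
From mathcomp Require Import boolp classical_sets cardinality fsbigop.

Set Implicit Arguments.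
Unset Strict Implicit.
Unset Printing Implicit Defensive.

Import GRing.Theory.

Local Open Scope nat_scope.

(* A cell is a pair (row, column).  Rows (from bottom to top) and columns (from
   left to right) are numbered from 0, and so are the parts of a composition;
   entries of fillings are numbered from 1. *)
Definition cell : Type := (nat * nat)%type.

Definition strong_composition (gamma : seq nat) : bool :=
  all (fun p => 0 < p) gamma.

Definition inc (gamma : seq nat) : seq nat := sort leq gamma.

(* Number of inversions of the one-line word of a permutation. *)
Definition perm_length (l : nat) (s : {perm 'I_l}) : nat :=
  #|[pred p : 'I_l * 'I_l | (p.1 < p.2) && (s p.2 < s p.1)]|.

Definition sorts_parts (gamma : seq nat) (s : {perm 'I_(size gamma)}) : bool :=
  [forall j, nth 0 gamma (s j) == nth 0 (inc gamma) j].

(* The default value 1%g is not used: some permutation sorts the parts. *)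
Definition beta (gamma : seq nat) : {perm 'I_(size gamma)} :=
  [arg max_(s > 1%g | sorts_parts s) perm_length s].

(* In what follows alpha is the list of column heights of a diagram. *)
Definition dg (alpha : seq nat) : seq cell :=
  [seq (r, c) | c <- iota 0 (size alpha), r <- iota 0 (nth 0 alpha c)].

Definition dghat (alpha : seq nat) : seq cell := [seq u <- dg alpha | 0 < u.1].

(* Only meaningful on cells that are not in the bottom row. *)
Definition South (u : cell) : cell := (u.1.-1, u.2).

Definition leg (alpha : seq nat) (u : cell) : nat :=
  count (fun v => (v.2 == u.2) && (u.1 < v.1)) (dg alpha).

Definition arm_cells (alpha : seq nat) (u : cell) : seq cell :=
  [seq v <- dg alpha |
     [&& v.1 == u.1, u.2 < v.2 & nth 0 alpha v.2 <= nth 0 alpha u.2]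
  || [&& v.1.+1 == u.1, v.2 < u.2 & nth 0 alpha v.2 < nth 0 alpha u.2]].

Definition arm (alpha : seq nat) (u : cell) : nat := size (arm_cells alpha u).

Definition attack (u v : cell) : bool :=
  [|| (u.1 == v.1) && (u.2 != v.2),
      (u.1 == v.1.+1) && (v.2 < u.2)
    | (v.1 == u.1.+1) && (u.2 < v.2)].

(* Assignments of naturals to cells.  As 0 stands for the absence of an entry,
   the support being the diagram makes the entries positive. *)
Definition assignment := {fsfun cell -> nat with 0}.

Definition is_filling (alpha : seq nat) (T : assignment) : Prop :=
  finsupp T =i dg alpha.

Definition entries (alpha : seq nat) (T : assignment) : seq nat :=
  [seq T u | u <- dg alpha].

Definition Des (alpha : seq nat) (T : assignment) : seq cell :=
  [seq u <- dghat alpha | T (South u) < T u].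

Definition maj (alpha : seq nat) (T : assignment) : nat :=
  \sum_(u <- Des alpha T) (leg alpha u + 1).

Definition coinv_triple (T : assignment) (x y z : cell) : bool :=
  [|| T x < T z < T y, T z < T y < T x | T y < T x < T z].

Definition coinv (alpha : seq nat) (T : assignment) : nat :=
  \sum_(x <- dghat alpha)
     count (fun z => coinv_triple T x (South x) z) (arm_cells alpha x).

Definition nonattacking (alpha : seq nat) (T : assignment) : Prop :=
  forall u v, u \in dg alpha -> v \in dg alpha -> attack u v -> T u <> T v.

Definition bottom_row_like_beta (gamma : seq nat) (T : assignment) : Prop :=
  forall i j : 'I_(size gamma),
    (T (0, val i) < T (0, val j)) = (beta gamma i < beta gamma j).

Definition NAT (gamma : seq nat) : set assignment :=
  [set T | [/\ is_filling (inc gamma) T, nonattacking (inc gamma) T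
             & bottom_row_like_beta gamma T]]%classic.

Definition ST (gamma : seq nat) : set assignment :=
  [set tau | [/\ is_filling (inc gamma) tau,
                 perm_eq (entries (inc gamma) tau) (iota 1 (sumn gamma))
               & bottom_row_like_beta gamma tau]]%classic.

Definition ST1 (gamma : seq nat) : set assignment :=
  [set tau | ST gamma tau /\
     forall u, u \in Des (inc gamma) tau -> tau u = (tau (South u)).+1]%classic.

(* The cell of a standard filling with entry i. *)
Definition cell_of (alpha : seq nat) (tau : assignment) (i : nat) : cell :=
  nth (0, 0) (dg alpha) (index i (entries alpha tau)).

Definition coinvDes (alpha : seq nat) (tau : assignment) : nat :=
  \sum_(u <- Des alpha tau) arm alpha u.

Definition omega (gamma : seq nat) (tau : assignment) : int :=
  ((size (dghat (inc gamma)))%:Z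
   - (count (fun i => (cell_of (inc gamma) tau i).2
                      == (cell_of (inc gamma) tau i.+1).2)
            (iota 1 (sumn gamma).-1))%:Z)%R.

Definition reading_before (u v : cell) : bool :=
  (v.1 < u.1) || ((u.1 == v.1) && (u.2 < v.2)).

Definition in_ID (alpha : seq nat) (tau : assignment) (i : nat) : bool :=
  reading_before (cell_of alpha tau i.+1) (cell_of alpha tau i).

(* The cells of column c in rows b, ..., e all lie in the diagram, and they are
   descents except for the bottom one. *)
Definition descent_run (alpha : seq nat) (tau : assignment) (c b e : nat) : Prop :=
  [/\ b <= e, (e, c) \in dg alpha, (b, c) \notin Des alpha tau
    & forall r, b < r <= e -> (r, c) \in Des alpha tau].

Definition in_descent_group (alpha : seq nat) (tau : assignment) (u v : cell) : Prop :=
  exists b e, [/\ descent_run alpha tau u.2 b e, b <= u.1 <= e,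
      (forall b' e', descent_run alpha tau u.2 b' e' -> b' <= b -> e <= e' ->
         b' = b /\ e' = e)
    & v.2 = u.2 /\ b <= v.1 <= e].

Definition attacks_through_descents (alpha : seq nat) (tau : assignment) (i : nat) : Prop :=
  exists u v, [/\ in_descent_group alpha tau (cell_of alpha tau i) u,
                  in_descent_group alpha tau (cell_of alpha tau i.+1) v
                & attack u v].

Definition Vhat (gamma : seq nat) (tau : assignment) : set nat :=
  [set i | 1 <= i < sumn gamma /\
     (in_ID (inc gamma) tau i \/ attacks_through_descents (inc gamma) tau i)]%classic.

Local Open Scope ring_scope.

(* A formal power series in x_1, x_2, ... is the function giving the coefficient
   of each monomial, a monomial being the multiset of the indices of its
   variables; the index 0 is allowed but never occurs below. *)
Definition powser (R : Type) : Type := {mset nat}%mset -> R.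

(* The sum of the w i * mon i for i in A, meant for families in which each
   monomial is mon i for finitely many i in A only. *)
Definition formal_sum (R : nmodType) (I : choiceType) (A : set I)
    (mon : I -> {mset nat}%mset) (w : I -> R) : powser R :=
  fun m => \sum_(i \in [set i | A i /\ mon i = m]%classic) w i.

Definition xmon (alpha : seq nat) (T : assignment) : {mset nat}%mset :=
  seq_mset (entries alpha T).

Definition wt (K : fieldType) (q t : K) (alpha : seq nat) (T : assignment) : K :=
  q ^+ maj alpha T * t ^+ coinv alpha T *
  \prod_(u <- dghat alpha | T u != T (South u))
     ((1 - t) / (1 - q ^+ (leg alpha u + 1) * t ^+ (arm alpha u + 1))).

Definition Gpar (K : fieldType) (q t : K) (gamma : seq nat) : powser K :=
  formal_sum (NAT gamma) (xmon (inc gamma)) (wt q t (inc gamma)).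

Notation Qt := {fraction {poly rat}}.
Notation Qqt := {fraction {poly Qt}}.

Definition tvar : Qt := tofrac ('X : {poly rat}).

(* q and t as elements of Q(t)(q) = Q(q,t). *)
Definition q_qt : Qqt := tofrac ('X : {poly Qt}).
Definition t_qt : Qqt := tofrac (tvar%:P : {poly Qt}).

Definition G (gamma : seq nat) : powser Qqt := Gpar q_qt t_qt gamma.

(* The value at 0 of a rational function, computed from its reduced form (and
   meaningless if 0 is a pole); see spec0_div. *)
Definition spec0 (K : fieldType) (f : {fraction {poly K}}) : K :=
  let n := \n_(repr f) in let d := \d_(repr f) in
  (n %/ gcdp n d).[0] / (d %/ gcdp n d).[0].

Lemma spec0_div (K : fieldType) (n d : {poly K}) :
  d.[0] != 0 -> spec0 (tofrac n / tofrac d) = n.[0] / d.[0].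
Proof.
move=> d00; have dn0 : d != 0 by apply: contraNneq d00 => ->; rewrite horner0.
rewrite /spec0; set f := tofrac n / tofrac d; set a := \n_(repr f); set b := \d_(repr f).
have bn0 : b != 0 by exact: denom_ratioP.
have fE : f = tofrac a / tofrac b.
  apply: (canRL (mulfK _)); first by rewrite tofrac_eq0.
  rewrite -{1}[f]reprK; unlock tofrac; rewrite -[LHS]FracField.pi_mul; apply/eqmodP => /=.
  rewrite /equivf /FracField.mulf !numden_Ratio ?mulf_neq0 ?oner_eq0 //=.
  by rewrite !mulr1 mulrC.
have ab : a * d = n * b.
  apply/eqP; rewrite -tofrac_eq !tofracM; apply/eqP.
  have /eqP := fE; rewrite /f eqr_div ?tofrac_eq0 // => /eqP <-.
  by rewrite mulrC.
set g := gcdp a b; have gn0 : g != 0 by rewrite gcdp_eq0 (negPf bn0) andbF.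
have aE : a %/ g * g = a by rewrite divpK // dvdp_gcdl.
have bE : b %/ g * g = b by rewrite divpK // dvdp_gcdr.
have ab' : a %/ g * d = n * (b %/ g).
  by apply: (mulIf gn0); rewrite mulrAC aE ab -mulrA bE.
have co : coprimep (b %/ g) (a %/ g).
  by rewrite coprimep_sym coprimep_div_gcd // bn0 orbT.
have /dvdpP[k dE] : b %/ g %| d.
  by rewrite -(Gauss_dvdpr _ co) ab' dvdp_mull.
have b00 : (b %/ g).[0] != 0.
  by apply: contraNneq d00 => e; rewrite dE hornerM e mulr0.
apply/eqP; rewrite eqr_div // -!hornerM ab'; exact/eqP.
Qed.

Definition Gq0 (gamma : seq nat) : powser Qt := fun m => spec0 (G gamma m).

(* Only the elements of S in {1, ..., n - 1} matter; the j-th factor, counted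
   from 1, is nth 0 s j.-1. *)
Definition fundamental (R : pzSemiRingType) (n : nat) (S : set nat) : powser R :=
  formal_sum
    [set s : n.-tuple nat | [/\ all (fun i => 0 < i)%N s, sorted leq s
       & forall j, (1 <= j < n)%N -> S j -> nth 0%N s j.-1 <> nth 0%N s j]]%classic
    (fun s => seq_mset s) (fun=> 1).

(* Main.v *)
(* Write alpha for inc gamma. Reversing every descent group of a filling tau in
   ST1 gamma gives a standard filling sigma without descents; tau is recovered
   from sigma together with the set D of the entries lying directly below a
   descent of tau, and D may be any set of i such that i and i+1 lie in the same
   column of sigma. Under this correspondence
     coinv tau - coinvDes tau = coinv sigma,  Vhat tau = D union Vhat sigma,
   and omega only depends on sigma. Fix a monomial, that is, a weakly increasing
   word s. The pairs (sigma, s) with s strict on Vhat sigma are the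
   standardizations of the non-attacking fillings T = s o sigma without descents
   (equal entries are ordered by reading order), and coinv T = coinv sigma. For a
   fixed T, summing (-t)^|D| over the admissible D gives 1 - t to the number of i
   with i, i+1 in the same column and s_i < s_(i+1), which completes
   (1-t)^omega to the weight of T at q = 0. *)
Require Import Defs.
From mathcomp Require Import all_boot all_order all_algebra.
From mathcomp Require Import finmap multiset.
From mathcomp Require Import boolp classical_sets cardinality fsbigop.
From mathcomp Require Import zify.

Set Implicit Arguments.
Unset Strict Implicit.
Unset Printing Implicit Defensive.

Import GRing.Theory.

(** * Reversing the maximal runs of a set of integers *)

Section Blocks.

Variables (n : nat) (D : pred nat).
Hypothesis D_bound : forall i, D i -> 0 < i < n.

(** [D i] glues i to i+1; the blocks are the maximal glued intervals, and this is the lower end of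
    the block of i. *)
Fixpoint block_min i :=
  if i is j.+1 then (if D j then block_min j else i) else 0.

(** The upward search runs on fuel; n units suffice, as [D] has no element beyond n - 1. *)
Fixpoint block_max_rec k i :=
  if k is k'.+1 then (if D i then block_max_rec k' i.+1 else i) else i.

Definition block_max i := block_max_rec n i.

Definition block_flip i := block_min i + block_max i - i.

Lemma block_min_le i : block_min i <= i.
Proof. by elim: i => //= i IH; case: ifP => // _; apply: leqW. Qed.

Lemma block_min_run i k : block_min i <= k < i -> D k.
Proof.
elim: i => //= i IH; case: ifP => Di; last by lia.
have [-> _ //|ki h] := eqVneq k i; by apply: IH; lia.
Qed.

Lemma block_min_stop i : 0 < block_min i -> ~~ D (block_min i).-1.
Proof. by elim: i => //= i IH; case: ifP => // ->. Qed.

Lemma block_minP i a :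
  a <= i -> (forall k, a <= k < i -> D k) -> (0 < a -> ~~ D a.-1) ->
  block_min i = a.
Proof.
move=> ai run stop; have lei := block_min_le i.
case: (ltngtP (block_min i) a) => // h.
  have a0 : 0 < a by lia.
  by have /negP[] := stop a0; apply: (@block_min_run i); lia.
have m0 : 0 < block_min i by lia.
by have /negP[] := block_min_stop m0; apply: run; lia.
Qed.

Lemma le_block_max i : i <= block_max i.
Proof.
rewrite /block_max; elim: n i => //= k IH i; case: ifP => // _.
by apply: leq_trans (IH _).
Qed.

Lemma block_max_run i k : i <= k < block_max i -> D k.
Proof.
rewrite /block_max; elim: n i => /= [|l IH] i; first by lia.
case: ifP => Di; last by lia.
have [-> _ //|ki h] := eqVneq k i; by apply: (IH i.+1); lia.
Qed.

Lemma block_max_stop i : ~~ D (block_max i).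
Proof.
have rec_stop k j : n <= j + k -> ~~ D (block_max_rec k j).
  elim: k j => /= [|k IH] j hn; first by apply/negP => /D_bound; lia.
  by case: ifP => [_|-> //]; apply: IH; lia.
by apply: rec_stop; rewrite leq_addl.
Qed.

Lemma block_maxP i b :
  i <= b -> (forall k, i <= k < b -> D k) -> ~~ D b -> block_max i = b.
Proof.
move=> ib run stop; have lei := le_block_max i.
case: (ltngtP (block_max i) b) => // h.
  by have /negP[] := block_max_stop i; apply: run; lia.
by have /negP[] := stop; apply: (@block_max_run i); lia.
Qed.

Lemma block_run i k : block_min i <= k < block_max i -> D k.
Proof.
move=> h; case: (ltnP k i) => ki; first by apply: (@block_min_run i); lia.
by apply: (@block_max_run i); lia.
Qed.

Lemma block_min_const i j :
  block_min i <= j <= block_max i -> block_min j = block_min i.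
Proof.
move=> h; apply: block_minP; first by lia.
  by move=> k hk; apply: (@block_run i); lia.
exact: block_min_stop.
Qed.

Lemma block_max_const i j :
  block_min i <= j <= block_max i -> block_max j = block_max i.
Proof.
move=> h; apply: block_maxP; first by lia.
  by move=> k hk; apply: (@block_run i); lia.
exact: block_max_stop.
Qed.

Lemma block_disjoint i j :
  i < j -> block_min i != block_min j -> block_max i < block_min j.
Proof.
move=> ij ne; rewrite ltnNge; apply/negP => h; case/eqP: ne.
have := block_min_le j; have := block_min_le i; have := le_block_max j.
have := le_block_max i => h1 h2 h3 h4.
case: (leqP (block_min j) i) => h5; first by apply: block_min_const; lia.
have e : block_min (block_min j) = block_min j by apply: block_min_const; lia.
by rewrite -e; apply/esym/block_min_const; lia.
Qed.

Lemma block_max_eq i j : block_min i = block_min j -> block_max i = block_max j.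
Proof.
move=> e; have := block_min_le j; have := block_min_le i.
have := le_block_max j; have := le_block_max i => h1 h2 h3 h4.
case: (leqP i j) => ij.
  by apply: block_max_const; lia.
by apply/esym/block_max_const; lia.
Qed.

Lemma block_min_gt0 i : 0 < i -> 0 < block_min i.
Proof.
move=> i0; rewrite lt0n; apply/eqP => e.
have /D_bound : D 0 by apply: (@block_min_run i); lia.
by [].
Qed.

Lemma block_max_leq i : i <= n -> block_max i <= n.
Proof.
move=> i_n; rewrite leqNgt; apply/negP => h.
have /D_bound : D n by apply: (@block_max_run i); lia.
by lia.
Qed.

Lemma block_flip_range i : block_min i <= block_flip i <= block_max i.
Proof. by have := block_min_le i; have := le_block_max i; rewrite /block_flip; lia. Qed.

Lemma block_min_flip i : block_min (block_flip i) = block_min i.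
Proof. exact/block_min_const/block_flip_range. Qed.

Lemma block_max_flip i : block_max (block_flip i) = block_max i.
Proof. exact/block_max_const/block_flip_range. Qed.

Lemma block_flipK : involutive block_flip.
Proof.
move=> i; rewrite {1}/block_flip block_min_flip block_max_flip /block_flip.
by have := block_min_le i; have := le_block_max i; lia.
Qed.

Lemma block_flip_bound i : 0 < i <= n -> 0 < block_flip i <= n.
Proof.
case/andP=> i0 i_n; have := block_flip_range i.
by have := block_min_gt0 i0; have := block_max_leq i_n; lia.
Qed.

(** Blocks are disjoint intervals and the flip maps each to itself. *)
Lemma block_flip_lt i j :
  block_min i != block_min j -> (block_flip i < block_flip j) = (i < j).
Proof.
move=> ne; have := block_flip_range i; have := block_flip_range j => hj hi.
have := block_min_le j; have := block_min_le i; have := le_block_max j.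
have := le_block_max i => h1 h2 h3 h4.
case: (ltngtP i j) => [ij|ji|e].
- by have := block_disjoint ij ne; lia.
- by rewrite eq_sym in ne; have := block_disjoint ji ne; lia.
- by rewrite e eqxx in ne.
Qed.

(** Both sums equal the sum of the two ends of the block; hence the flip reverses the order inside a
    block. *)
Lemma block_flip_same i j :
  block_min i = block_min j -> block_flip i + i = block_flip j + j.
Proof.
move=> e; have := block_max_eq e; rewrite /block_flip e.
have := block_min_le j; have := block_min_le i; have := le_block_max j.
have := le_block_max i; lia.
Qed.

Lemma block_minS i : D i -> block_min i.+1 = block_min i.
Proof. by move=> /= ->. Qed.

Lemma block_minSN i : ~~ D i -> block_min i.+1 = i.+1.
Proof. by move=> /= /negbTE ->. Qed.

Lemma block_maxN i : ~~ D i -> block_max i = i.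
Proof. by move=> Di; apply: block_maxP => // k; lia. Qed.

Lemma block_same_run i j k :
  block_min i = block_min j -> i <= k < j -> D k.
Proof.
move=> e h; apply: (@block_run i).
by rewrite (block_max_eq e); have := block_min_le i; have := le_block_max j; lia.
Qed.

End Blocks.

Arguments block_min D i : simpl never.

(** * Standard fillings *)

Definition North (u : cell) : cell := (u.1.+1, u.2).

Lemma NorthK (u : cell) : South (North u) = u.
Proof. by case: u. Qed.

Lemma SouthK (u : cell) : 0 < u.1 -> North (South u) = u.
Proof. by case: u => [[]]. Qed.

Section Fillings.

Variable alpha : seq nat.
Local Notation dga := (dg alpha).
Local Notation n := (size dga).

Lemma mem_dg (u : cell) : (u \in dga) = (u.1 < nth 0 alpha u.2).
Proof.
apply/allpairsPdep/idP => [[c [r [_ + ->]]]|h]; first by rewrite mem_iota.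
exists u.2, u.1; rewrite !mem_iota /= h; split=> //; last by case: u {h}.
by rewrite add0n ltnNge; apply: contraTN h => /(nth_default 0) ->.
Qed.

Lemma dg_uniq : uniq dga.
Proof.
apply: allpairs_uniq_dep => [|c _|]; rewrite ?iota_uniq //.
by move=> [c r] [c' r'] _ _ /= [-> ->].
Qed.

Lemma size_dg : n = sumn alpha.
Proof.
rewrite size_allpairs_dep; congr sumn.
under eq_map do rewrite size_iota.
by rewrite map_nth_iota0 // take_size.
Qed.

Lemma mem_dghat (u : cell) : (u \in dghat alpha) = (0 < u.1) && (u \in dga).
Proof. by rewrite mem_filter. Qed.

Lemma South_dg (u : cell) : u \in dga -> South u \in dga.
Proof. by rewrite !mem_dg /=; apply: leq_ltn_trans; rewrite leq_pred. Qed.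

Lemma dg_below r r' c : r' <= r -> (r, c) \in dga -> (r', c) \in dga.
Proof. by rewrite !mem_dg /=; apply: leq_ltn_trans. Qed.

Lemma mem_Des (T : assignment) (u : cell) :
  (u \in Des alpha T) = [&& 0 < u.1, u \in dga & T (South u) < T u].
Proof. by rewrite mem_filter mem_dghat andbC andbA. Qed.

Lemma arm_cells_column (x z : cell) :
  z \in arm_cells alpha x -> z \in dga /\ z.2 != x.2.
Proof.
by case: x z => [r c] [r' c']; rewrite mem_filter /= => /andP[h ->]; split=> //; lia.
Qed.

Definition mk_filling (f : cell -> nat) : assignment :=
  [fsfun u in [fset v in dga]%fset => f u].

Lemma mk_fillingE f (u : cell) : u \in dga -> mk_filling f u = f u.
Proof. by move=> hu; rewrite fsfunE inE /= hu. Qed.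

Lemma mk_filling_is_filling f :
  {in dga, forall u, 0 < f u} -> is_filling alpha (mk_filling f).
Proof.
move=> f0 u; rewrite mem_finsupp fsfunE inE /=.
by case: ifP => hu; rewrite ?eqxx // -lt0n f0.
Qed.

Lemma eq_filling T T' : is_filling alpha T -> is_filling alpha T' ->
  {in dga, T =1 T'} -> T = T'.
Proof.
move=> hT hT' e; apply/fsfunP => u.
case: (boolP (u \in dga)) => hu; first exact: e.
by rewrite !fsfun_dflt // (hT, hT').
Qed.

Lemma filling_gt0 (T : assignment) (u : cell) : is_filling alpha T -> u \in dga -> 0 < T u.
Proof. by move=> hT; rewrite -hT mem_finsupp lt0n. Qed.

Definition standard (tau : assignment) : Prop :=
  is_filling alpha tau /\ perm_eq (entries alpha tau) (iota 1 n).

Section Standard.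

Variable tau : assignment.
Hypothesis std : standard tau.

Lemma standard_entries_uniq : uniq (entries alpha tau).
Proof. by rewrite (perm_uniq std.2) iota_uniq. Qed.

Lemma standard_bound (u : cell) : u \in dga -> 0 < tau u <= n.
Proof.
move=> hu; have : tau u \in entries alpha tau by apply: map_f.
by rewrite (perm_mem std.2) mem_iota; lia.
Qed.

Lemma standard_inj : {in dga &, injective tau}.
Proof.
move=> u v hu hv e; rewrite -(nth_index (0, 0) hu) -(nth_index (0, 0) hv).
congr nth; apply/eqP.
rewrite -(nth_uniq 0 _ _ standard_entries_uniq) ?size_map ?index_mem //.
by rewrite !(nth_map (0, 0)) ?index_mem // !nth_index // e.
Qed.

Lemma cell_of_dg i : 0 < i <= n -> cell_of alpha tau i \in dga.
Proof.
move=> hi; apply: mem_nth; rewrite -(size_map tau) index_mem.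
by rewrite (perm_mem std.2) mem_iota; lia.
Qed.

Lemma cell_ofK i : 0 < i <= n -> tau (cell_of alpha tau i) = i.
Proof.
move=> hi; have hidx : i \in entries alpha tau.
  by rewrite (perm_mem std.2) mem_iota; lia.
rewrite /cell_of -[RHS](nth_index 0 hidx) (nth_map (0, 0)) //.
by rewrite -(size_map tau) index_mem.
Qed.

Lemma cell_of_val (u : cell) : u \in dga -> cell_of alpha tau (tau u) = u.
Proof.
move=> hu; have hb := standard_bound hu.
by apply: standard_inj; rewrite ?cell_of_dg ?cell_ofK.
Qed.

Lemma cell_of_inj i j : 0 < i <= n -> 0 < j <= n ->
  cell_of alpha tau i = cell_of alpha tau j -> i = j.
Proof. by move=> hi hj e; rewrite -(cell_ofK hi) e cell_ofK. Qed.

End Standard.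

Definition decreasing (T : assignment) : Prop :=
  {in dghat alpha, forall u, T u <= T (South u)}.

Lemma decreasingP T : Des alpha T = [::] <-> decreasing T.
Proof.
split=> [e u hu|h].
  have : u \notin Des alpha T by rewrite e.
  by rewrite mem_filter hu andbT -leqNgt.
apply/eqP; rewrite -size_eq0 size_filter -leqn0 leqNgt -has_count; apply/negP.
by case/hasP=> u hu; rewrite ltnNge h.
Qed.

Lemma decreasing_column T r r' c : decreasing T -> r <= r' ->
  (r', c) \in dga -> T (r', c) <= T (r, c).
Proof.
move=> dT; elim: r' => [|r' IH]; first by rewrite leqn0 => /eqP ->.
rewrite leq_eqVlt => /orP[/eqP -> //|rr' hd].
have := IH rr' (dg_below (leqnSn _) hd); apply: leq_trans.
by apply: dT; rewrite mem_dghat.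
Qed.

Lemma decreasing_row (T : assignment) (u v : cell) : standard T -> decreasing T ->
  u \in dga -> v \in dga -> u.2 = v.2 -> T u < T v -> v.1 < u.1.
Proof.
case: u => r c; case: v => r' c' /= _ dT hu hv e; rewrite -{c'}e in hv *.
by rewrite !ltnNge; apply: contraNN => h; apply: decreasing_column.
Qed.

(** * Reversing the blocks of entries of a standard filling *)

Definition flip_filling D tau : assignment :=
  mk_filling (fun u => block_flip n D (tau u)).

Section Flip.

Variables (tau : assignment) (D : pred nat).
Hypothesis std : standard tau.
Hypothesis D_bound : forall i, D i -> 0 < i < n.

Local Notation flip := (block_flip n D).
Local Notation bmin := (block_min D).

Lemma flip_fillingE (u : cell) : u \in dga -> flip_filling D tau u = flip (tau u).
Proof. exact: mk_fillingE. Qed.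

Lemma flip_filling_standard : standard (flip_filling D tau).
Proof.
split.
  apply: mk_filling_is_filling => u /(standard_bound std) h.
  by have := block_flip_bound D_bound h; lia.
have -> : entries alpha (flip_filling D tau) = map flip (entries alpha tau).
  by rewrite /entries -map_comp; apply/eq_in_map => u; apply: flip_fillingE.
apply: (@perm_trans _ (map flip (iota 1 n))); first exact/perm_map/std.2.
have u1 : uniq (map flip (iota 1 n)).
  by rewrite map_inj_uniq ?iota_uniq //; apply/inv_inj/block_flipK.
apply: uniq_perm; rewrite ?iota_uniq // => i.
apply/mapP/idP => [[j]|]; rewrite !mem_iota => h.
  by move=> ->; have := @block_flip_bound n D D_bound j; lia.
exists (flip i); last by rewrite block_flipK.
by rewrite mem_iota; have := @block_flip_bound n D D_bound i; lia.
Qed.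

Lemma cell_of_flip i : 0 < i <= n ->
  cell_of alpha (flip_filling D tau) i = cell_of alpha tau (flip i).
Proof.
move=> hi; have hf := block_flip_bound D_bound hi.
apply: (standard_inj flip_filling_standard).
- by apply: cell_of_dg => //; apply: flip_filling_standard.
- exact: cell_of_dg.
- rewrite cell_ofK //; last exact: flip_filling_standard.
  by rewrite flip_fillingE ?cell_of_dg // cell_ofK // block_flipK.
Qed.

Lemma flip_fillingK : flip_filling D (flip_filling D tau) = tau.
Proof.
apply: eq_filling => [||u hu]; last first.
- by rewrite mk_fillingE // flip_fillingE // block_flipK.
- exact: std.1.
- apply: mk_filling_is_filling => u hu.
  have := standard_bound flip_filling_standard hu.
  by move/(block_flip_bound D_bound); lia.
Qed.

(** A block climbs one column with consecutive entries, so row minus entry is constant on it; the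
    sums avoid truncated subtraction. *)
Lemma climb_block i j :
  (forall k, D k -> cell_of alpha tau k.+1 = North (cell_of alpha tau k)) ->
  bmin i = bmin j ->
  (cell_of alpha tau i).2 = (cell_of alpha tau j).2
  /\ (cell_of alpha tau i).1 + j = (cell_of alpha tau j).1 + i.
Proof.
move=> climb; wlog ij : i j / i <= j.
  move=> H e; case: (leqP i j) => [|/ltnW] ij; first exact: H.
  by have [-> ?] := H _ _ ij (esym e); split=> //; lia.
move=> e; have : forall k, k <= j - i ->
    cell_of alpha tau (i + k) = ((cell_of alpha tau i).1 + k, (cell_of alpha tau i).2).
  elim=> [|k IH] hk; first by rewrite !addn0 -surjective_pairing.
  rewrite addnS climb; last first.
    by apply: (block_same_run D_bound e); lia.
  by rewrite IH ?addnS //; lia.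
by move/(_ _ (leqnn _)); rewrite subnKC // => -> /=; split=> //; lia.
Qed.

(** The mirror image of [climb_block]: here row plus entry is constant on a block. *)
Lemma fall_block i j :
  (forall k, D k -> cell_of alpha tau k = North (cell_of alpha tau k.+1)) ->
  bmin i = bmin j ->
  (cell_of alpha tau i).2 = (cell_of alpha tau j).2
  /\ (cell_of alpha tau i).1 + i = (cell_of alpha tau j).1 + j.
Proof.
move=> fall; wlog ij : i j / i <= j.
  move=> H e; case: (leqP i j) => [|/ltnW] ij; first exact: H.
  by have [-> ?] := H _ _ ij (esym e); split=> //; lia.
move=> e; have : forall k, k <= j - i ->
    (cell_of alpha tau (i + k)).1 + k = (cell_of alpha tau i).1 /\
    (cell_of alpha tau (i + k)).2 = (cell_of alpha tau i).2.
  elim=> [|k IH] hk; first by rewrite !addn0.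
  have Dk : D (i + k) by apply: (block_same_run D_bound e); lia.
  have [h1 h2] := IH (ltnW hk); move: h1 h2; rewrite (fall _ Dk) /= (addnS i).
  by split=> //; lia.
by case/(_ _ (leqnn _)); rewrite subnKC // => <- ->; split=> //; lia.
Qed.

(** Different bottom cells lie in different columns, hence in different blocks, whose order the flip
    keeps. *)
Lemma bottom_row_flip (gamma : seq nat) :
  (forall c, c < size gamma -> (0, c) \in dga) ->
  (forall i j, bmin i = bmin j ->
     (cell_of alpha tau i).2 = (cell_of alpha tau j).2) ->
  bottom_row_like_beta gamma tau ->
  bottom_row_like_beta gamma (flip_filling D tau).
Proof.
move=> hdg hcol hb i j.
have hd (k : 'I_(size gamma)) : (0, val k) \in dga by apply/hdg/ltn_ord.
rewrite -hb !flip_fillingE ?hd //.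
have [->|ij] := eqVneq i j; first by rewrite !ltnn.
apply: block_flip_lt => //; apply/eqP => /hcol.
by rewrite !cell_of_val ?hd //= => /val_inj /eqP; rewrite (negPf ij).
Qed.

End Flip.

End Fillings.

(** * From ST1 to standard fillings without descents *)

Definition same_column alpha (tau : assignment) i : bool :=
  (cell_of alpha tau i).2 == (cell_of alpha tau i.+1).2.

(* Membership in Vhat for a filling without descents. *)
Definition attack_or_ID alpha (tau : assignment) i : bool :=
  in_ID alpha tau i || attack (cell_of alpha tau i) (cell_of alpha tau i.+1).

(* For a filling in ST1 these are the i such that i + 1 is a descent, and the
   descent groups are the maximal runs of this set. *)
Definition descent_floor alpha (tau : assignment) : pred nat :=
  fun i => has (fun u => tau (South u) == i) (Des alpha tau).

Section UnitDescents.

Variables (alpha : seq nat) (tau : assignment).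
Local Notation dga := (dg alpha).
Local Notation n := (size dga).
Hypothesis std : standard alpha tau.
Hypothesis unit_descents :
  forall u : Defs.cell, u \in Des alpha tau -> tau u = (tau (South u)).+1.

Local Notation D := (descent_floor alpha tau).
Local Notation flip := (block_flip n D).
Local Notation bmin := (block_min D).
Local Notation bmax := (block_max n D).
Local Notation cell := (cell_of alpha tau).
Local Notation sigma := (flip_filling alpha D tau).

Lemma descent_floor_bound i : D i -> 0 < i < n.
Proof.
case/hasP=> u hu /eqP <-; have := unit_descents hu.
move: hu; rewrite mem_Des => /and3P[u0 hu _].
by have := standard_bound std hu; have := standard_bound std (South_dg hu); lia.
Qed.
Let Db := descent_floor_bound.

Lemma descent_floor_South (u : Defs.cell) : u \in Des alpha tau -> D (tau (South u)).
Proof. by move=> hu; apply/hasP; exists u. Qed.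

Lemma climb_descent_floor i : D i -> cell i.+1 = North (cell i).
Proof.
case/hasP=> u hu /eqP <-; rewrite -(unit_descents hu).
move: hu; rewrite mem_Des => /and3P[u0 hu _].
by rewrite !cell_of_val ?South_dg // SouthK.
Qed.

Lemma block_cells i j : bmin i = bmin j ->
  (cell i).2 = (cell j).2 /\ (cell i).1 + j = (cell j).1 + i.
Proof. exact: (climb_block Db climb_descent_floor). Qed.

(** A descent is glued to the cell below by [descent_floor]. Conversely row minus entry is constant
    on a block, so the upper of two adjacent cells of a block has the larger entry. *)
Lemma mem_Des_block (u : Defs.cell) : (u \in Des alpha tau) =
  [&& 0 < u.1, u \in dga & bmin (tau u) == bmin (tau (South u))].
Proof.
apply/idP/idP => [hu|/and3P[u0 hu /eqP e]].
  have /and3P[-> -> _] : [&& 0 < u.1, u \in dga & tau (South u) < tau u].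
    by rewrite -mem_Des.
  by rewrite (unit_descents hu) (block_minS (descent_floor_South hu)) eqxx.
have [_] := block_cells e; rewrite mem_Des u0 hu /=.
by rewrite !cell_of_val ?South_dg //=; lia.
Qed.

(** A descent shares a block with the cell below, and the flip reverses their order; any other
    vertical pair meets two blocks and keeps its order. *)
Lemma flip_filling_decreasing : decreasing alpha sigma.
Proof.
move=> u; rewrite mem_dghat => /andP[u0 hu].
rewrite !flip_fillingE ?South_dg //.
have [e|ne] := eqVneq (bmin (tau u)) (bmin (tau (South u))).
  have := block_flip_same Db e.
  have hu' : u \in Des alpha tau by rewrite mem_Des_block u0 hu e eqxx.
  by rewrite (unit_descents hu'); lia.
rewrite leqNgt block_flip_lt // 1?eq_sym //.
by apply: contra ne => h; have := mem_Des_block u; rewrite mem_Des u0 hu h /= => <-.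
Qed.

(** An entry moves only within its block, hence within its column. This makes [omega] invariant. *)
Lemma same_column_flip i : 0 < i < n ->
  same_column alpha sigma i = same_column alpha tau i.
Proof.
move=> hi; rewrite /same_column !cell_of_flip //; try lia.
have [-> _] := block_cells (block_min_flip n D i).
by have [-> _] := block_cells (block_min_flip n D i.+1).
Qed.

Lemma descent_floor_same_column i : D i -> same_column alpha sigma i.
Proof.
move=> Di; rewrite same_column_flip ; last exact: Db.
by rewrite /same_column climb_descent_floor.
Qed.

(** A descent is determined by the entry below it, so the descents are counted by the elements of
    [D]. *)
Lemma perm_descent_floor :
  perm_eq [seq tau (South u) | u <- Des alpha tau] (filter D (iota 0 n)).
Proof.
apply: uniq_perm; rewrite ?filter_uniq ?iota_uniq //.
  rewrite map_inj_in_uniq ?filter_uniq ?dg_uniq // => u v.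
  rewrite !mem_Des => /and3P[u0 hu _] /and3P[v0 hv _] e.
  rewrite -(SouthK u0) -(SouthK v0); congr North.
  by apply: (standard_inj std); rewrite ?South_dg.
move=> i; rewrite mem_filter mem_iota /=; apply/mapP/andP => [[u hu ->]|[]].
  by have Du := descent_floor_South hu; rewrite Du; have := Db Du; lia.
by case/hasP=> u hu /eqP <- _; exists u.
Qed.

(* At a descent x every triple is a coinversion of tau and none is one of sigma,
   the entries of x and South x being consecutive; at the other cells the entries
   of a triple lie in distinct blocks, whose order the flip preserves. *)
Lemma coinv_flip : coinv alpha tau = coinvDes alpha tau + coinv alpha sigma.
Proof.
rewrite /coinvDes /Des big_filter [X in X + _]big_mkcond -big_split.
apply: eq_big_seq => x; rewrite mem_dghat => /andP[x0 hx].
have hy := South_dg hx.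
have tz z (u : Defs.cell) : z \in arm_cells alpha x -> u \in dga -> u.2 = x.2 ->
    tau z != tau u.
  case/arm_cells_column=> hz cz hu cu; apply: contra cz => /eqP e.
  by rewrite (standard_inj std hz hu e) cu.
have := mem_Des_block x; rewrite mem_Des x0 hx /= => ->; rewrite /arm.
case: eqP => [e|/eqP ne].
  have hd : x \in Des alpha tau by rewrite mem_Des_block x0 hx e eqxx.
  have xE := unit_descents hd; have := block_flip_same Db e; rewrite xE => fE.
  rewrite -[LHS]addn0; congr (_ + _).
    rewrite -[RHS]count_predT; apply: eq_in_count => z hz.
    have := tz z x hz hx erefl; have := tz z _ hz hy erefl.
    by rewrite /coinv_triple xE /=; lia.
  apply/esym/eqP; rewrite -leqn0 leqNgt -has_count; apply/negP => /hasP[z hz].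
  have [hzd _] := arm_cells_column hz.
  by rewrite /coinv_triple !flip_fillingE // xE; lia.
rewrite add0n; apply: eq_in_count => z hz; have [hzd cz] := arm_cells_column hz.
have bz (u : Defs.cell) : u \in dga -> u.2 = x.2 -> bmin (tau z) != bmin (tau u).
  move=> hu ux; apply: contra cz => /eqP /block_cells[+ _].
  by rewrite !cell_of_val // ux => ->.
have := ne; have := bz x hx erefl; have := bz _ hy erefl => b1 b2 b3.
rewrite /coinv_triple !flip_fillingE // !block_flip_lt // eq_sym //.
Qed.

Lemma block_run_rows (u : Defs.cell) r : u \in dga ->
  (cell (bmin (tau u))).1 <= r <= (cell (bmax (tau u))).1 ->
  (r, u.2) \in dga /\
  tau (r, u.2) = bmin (tau u) + (r - (cell (bmin (tau u))).1).
Proof.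
move=> hu h; have hb := standard_bound std hu.
set i := tau u in h hb *; set b := (cell (bmin i)).1 in h *.
have lei := block_min_le D i; have gei := le_block_max n D i.
have bm0 : 0 < bmin i by apply: (block_min_gt0 Db); lia.
have bMn : bmax i <= n by apply: (block_max_leq Db); lia.
have m1 : bmin (bmin i) = bmin i by apply: (block_min_const (n := n)) => //; lia.
have m2 : bmin (bmax i) = bmin i by apply: (block_min_const (n := n)) => //; lia.
have [_ h1] := block_cells m1; have [_ h2] := block_cells m2.
have hk : bmin i <= bmin i + (r - b) <= bmax i by rewrite /b; lia.
have [c3 h3] := block_cells (block_min_const hk).
have e : cell (bmin i + (r - b)) = (r, u.2).
  rewrite [LHS]surjective_pairing c3 cell_of_val //; congr pair.
  by rewrite /b in hk h3 h *; lia.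
rewrite -e; split; last by rewrite cell_ofK //; lia.
by apply: cell_of_dg => //; lia.
Qed.

(** The descent group of u consists of the cells of its block: the bottom cell of the block and the
    cell above its top are not descents, while its other cells are, so the maximal run through u has
    the same ends. *)
Lemma in_descent_groupE (u v : Defs.cell) : u \in dga ->
  in_descent_group alpha tau u v <->
  v.2 = u.2 /\ (cell (bmin (tau u))).1 <= v.1 <= (cell (bmax (tau u))).1.
Proof.
move=> hu; have hb := standard_bound std hu; have rows := block_run_rows hu.
set i := tau u in hb rows *; set b := (cell (bmin i)).1 in rows *.
set e := (cell (bmax i)).1 in rows *.
have lei := block_min_le D i; have gei := le_block_max n D i.
have m1 : bmin (bmin i) = bmin i by apply: (block_min_const (n := n)) => //; lia.
have m2 : bmin (bmax i) = bmin i by apply: (block_min_const (n := n)) => //; lia.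
have [_] := block_cells m1; have [_] := block_cells m2.
rewrite cell_of_val // -/b -/e => h1 h2.
have be : b <= u.1 <= e by lia.
have [eb tb] : (b, u.2) \in dga /\ tau (b, u.2) = bmin i.
  by have [|-> ->] := rows b; [lia | split=> //; lia].
have [ee te] : (e, u.2) \in dga /\ tau (e, u.2) = bmax i.
  by have [|-> ->] := rows e; [lia | split=> //; lia].
have Dsb : (b, u.2) \notin Des alpha tau.
  apply/negP => hd; have := unit_descents hd; have := descent_floor_South hd.
  rewrite tb => + e1; rewrite e1 in m1.
  have b0 : 0 < bmin i by rewrite e1.
  by have := block_min_stop b0; rewrite e1 /= => /negP.
have Dse : (e.+1, u.2) \notin Des alpha tau.
  apply/negP => /descent_floor_South; rewrite /South /= te.
  exact/negP/(block_max_stop Db).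
have Ds r : b < r <= e -> (r, u.2) \in Des alpha tau.
  move=> hr; have [|hd1 t1] := rows r; first by lia.
  have [|hd2 t2] := rows r.-1; first by lia.
  by rewrite mem_Des /South /= hd1 t1 t2; lia.
have run : descent_run alpha tau u.2 b e by split=> //; lia.
split=> [[b' [e' [[be' he' hb' hr']]]] bue mx [-> hv]|[vu hv]].
  have ebb : b' = b.
    case: (ltngtP b' b) => // hlt.
      by case/negP: Dsb; apply: hr'; lia.
      by case/negP: hb'; apply: Ds; lia.
  case: (leqP e' e) => hee; last first.
    by case/negP: Dse; apply: hr'; lia.
  have [_ e1] : b = b' /\ e = e' by apply: mx => //; lia.
  by move: hv; rewrite -e1 ebb.
exists b, e; split=> // b' e' [be' he' hb' hr'] bb ee'.
have bb' : b' = b.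
  case: (ltngtP b' b) => // hlt; last by lia.
  by case/negP: Dsb; apply: hr'; lia.
split=> //; case: (ltngtP e' e) => // hlt; first by lia.
by case/negP: Dse; apply: hr'; lia.
Qed.

(* If i is not in D then it is the top of its group and i + 1 is the bottom of
   its own, so that i is outside Vhat tau iff the group of i lies entirely above
   that of i + 1 without attacking it. In sigma the facing ends of the two groups
   carry i and i + 1. *)
Lemma Vhat_flip i : 0 < i < n ->
  (in_ID alpha tau i \/ attacks_through_descents alpha tau i) <->
  (D i \/ attack_or_ID alpha sigma i).
Proof.
move=> hi; have [Di|Di] := boolP (D i).
  split; first by left.
  by left; rewrite /in_ID /reading_before climb_descent_floor //= ltnSn.
have hi1 : 0 < i <= n by lia.
have hi2 : 0 < i.+1 <= n by lia.
have groupE j v : 0 < j <= n -> in_descent_group alpha tau (cell j) v <->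
    v.2 = (cell j).2 /\ (cell (bmin j)).1 <= v.1 <= (cell (bmax j)).1.
  by move=> hj; rewrite in_descent_groupE ?cell_of_dg // cell_ofK.
have lei := block_min_le D i; have gei := le_block_max n D i.+1.
have mi : bmin (bmin i) = bmin i.
  by apply: (block_min_const (n := n)) => //; rewrite (block_maxN Db) //; lia.
have mi1 : bmin (bmax i.+1) = bmin i.+1.
  by apply: (block_min_const (n := n)) => //; rewrite block_minSN //; lia.
have f1 : flip i = bmin i by rewrite /block_flip (block_maxN Db) //; lia.
have f2 : flip i.+1 = bmax i.+1 by rewrite /block_flip block_minSN //; lia.
have [c1 r1] := block_cells mi; have [c2 r2] := block_cells mi1.
have s1 : cell_of alpha sigma i = cell (bmin i) by rewrite (cell_of_flip std Db) // f1.
have s2 : cell_of alpha sigma i.+1 = cell (bmax i.+1).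
  by rewrite (cell_of_flip std Db) // f2.
have att : attacks_through_descents alpha tau i <->
    exists r r', [/\ (cell (bmin i)).1 <= r <= (cell i).1,
      (cell i.+1).1 <= r' <= (cell (bmax i.+1)).1
      & attack (r, (cell i).2) (r', (cell i.+1).2)].
  split=> [[[r c] [[r' c'] [] ]]|[r [r' [h1 h2 h3]]]].
    move=> /groupE[] // /= -> h1 /groupE[] // /= -> h2 h3.
    by exists r, r'; rewrite (block_maxN Db) // in h1; rewrite block_minSN // in h2.
  exists (r, (cell i).2), (r', (cell i.+1).2); split=> //.
    by apply/groupE => //=; rewrite (block_maxN Db).
  by apply/groupE => //=; rewrite block_minSN.
rewrite {}att /attack_or_ID /in_ID s1 s2.
(* In a common column both sides fail: [sigma] decreases upwards, so the whole group of i lies above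
   that of i+1, and cells of one column do not attack each other. *)
have [ec|nc] := eqVneq (cell i).2 (cell i.+1).2.
  have lt : (cell_of alpha sigma i.+1).1 < (cell_of alpha sigma i).1.
    have sstd := flip_filling_standard std Db.
    apply: (decreasing_row sstd flip_filling_decreasing); rewrite ?cell_of_dg ?cell_ofK //.
    by rewrite s1 s2 c1 c2.
  rewrite s1 s2 in lt.
  rewrite /reading_before /attack c1 c2 /= ec; split=> [[|[r [r' []]]]|[]] //=; lia.
rewrite /reading_before /attack c1 c2 /=; split=> [h|[//|h]].
  right; case: h => [|[r [r' []]]]; lia.
set a1 := (cell (bmin i)).1 in r1 h *; set a2 := (cell i).1 in r1 h *.
set b1 := (cell i.+1).1 in r2 h *; set b2 := (cell (bmax i.+1)).1 in r2 h *.
case: (leqP b1 a2) => ba; last by left; lia.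
right.
(* If the row intervals of the two groups meet, a common row provides attacking cells; otherwise the
   facing ends attack, as in [sigma]. *)
case: (leqP a1 b2) => ab.
  by exists (maxn a1 b1), (maxn a1 b1); split; lia.
by exists a1, b2; split; lia.
Qed.

End UnitDescents.

(** * From standard fillings without descents to ST1 *)

Section DecreasingStandard.

Variables (alpha : seq nat) (sigma : assignment).
Local Notation dga := (dg alpha).
Local Notation n := (size dga).
Hypothesis std : standard alpha sigma.
Hypothesis dec : decreasing alpha sigma.
Local Notation cell := (cell_of alpha sigma).

(** i lies above i+1, and the entry directly above i+1 is at least i, at most i+1 and different from
    i+1. *)
Lemma same_column_North i : 0 < i < n -> same_column alpha sigma i ->
  cell i = North (cell i.+1).
Proof.
move=> hi /eqP hc.
have hu : cell i \in dga by apply: cell_of_dg => //; lia.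
have hv : cell i.+1 \in dga by apply: cell_of_dg => //; lia.
have su : sigma (cell i) = i by rewrite cell_ofK //; lia.
have sv : sigma (cell i.+1) = i.+1 by rewrite cell_ofK //; lia.
have lt : (cell i.+1).1 < (cell i).1.
  by apply: (decreasing_row std dec); rewrite ?su ?sv.
have hw : North (cell i.+1) \in dga.
  by apply: (dg_below lt); rewrite -hc -surjective_pairing.
have le1 : sigma (cell i) <= sigma (North (cell i.+1)).
  rewrite [in X in X <= _](surjective_pairing (cell i)) hc.
  by apply: (decreasing_column dec) => //; rewrite -hc -surjective_pairing.
have le2 : sigma (North (cell i.+1)) <= sigma (cell i.+1).
  by rewrite -[in X in _ <= X](NorthK (cell i.+1)); apply: dec; rewrite mem_dghat.
have ne : sigma (North (cell i.+1)) != sigma (cell i.+1).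
  apply/eqP => /(standard_inj std hw hv) /(congr1 fst) /= /eqP.
  by rewrite -[X in _ == X]addn0 -addn1 eqn_add2l.
by apply: (standard_inj std) => //; lia.
Qed.

Variable D : pred nat.
Hypothesis Db : forall i, D i -> 0 < i < n.
Hypothesis Dcol : forall i, D i -> same_column alpha sigma i.
Local Notation flip := (block_flip n D).
Local Notation bmin := (block_min D).
Local Notation tau := (flip_filling alpha D sigma).

Lemma fall_same_column i : D i -> cell i = North (cell i.+1).
Proof. by move=> Di; apply: same_column_North; [exact: Db|exact: Dcol]. Qed.

Lemma fall_block_column i j : bmin i = bmin j -> (cell i).2 = (cell j).2.
Proof. by case/(fall_block Db fall_same_column). Qed.

(** Between different blocks the order is kept, so no descent arises. Within a block row plus entry
    is constant in [sigma], so vertical neighbours carry consecutive entries, before and after the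
    flip. *)
Lemma flip_Des (u : Defs.cell) : u \in Des alpha tau ->
  tau u = (tau (South u)).+1 /\ D (tau (South u)).
Proof.
rewrite mem_Des => /and3P[u0 hu]; have hy := South_dg hu.
have hb := standard_bound std hu; have hby := standard_bound std hy.
rewrite !flip_fillingE //.
have su : sigma u <= sigma (South u) by apply: dec; rewrite mem_dghat u0.
have [e|ne] := eqVneq (bmin (sigma (South u))) (bmin (sigma u)); last first.
  by rewrite block_flip_lt //; lia.
move=> _; have [_] := fall_block Db fall_same_column e.
rewrite !cell_of_val //= => h; have := block_flip_same Db e => h'.
split; first by lia.
apply: (@block_run n D (sigma u)).
have := block_flip_range n D (sigma u); have := block_flip_range n D (sigma (South u)).
by rewrite e; lia.
Qed.

(** For i in [D] the flips of i and i+1 are consecutive and glued, so their cells are adjacent in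
    [sigma]; after the flip i+1 sits directly above i. Thus [D] can be read off the flipped
    filling. *)
Lemma flip_descent_floor : descent_floor alpha tau =1 D.
Proof.
move=> i; apply/idP/idP => [/hasP[u /flip_Des[_ h] /eqP <- //]|Di].
have hi := Db Di; have e := block_minS Di.
have h := block_flip_same Db e.
have hf := block_flip_bound Db (i := i); have hf1 := block_flip_bound Db (i := i.+1).
have D1 : D (flip i.+1).
  apply: (@block_run n D i); have := block_flip_range n D i.
  by have := block_flip_range n D i.+1; rewrite e (block_max_eq Db e); lia.
have c1 := fall_same_column D1.
have fE : (flip i.+1).+1 = flip i by lia.
rewrite fE in c1.
have d0 : cell (flip i) \in dga by apply: cell_of_dg => //; lia.
have d1 : cell (flip i.+1) \in dga by apply: cell_of_dg => //; lia.
have t0 : tau (cell (flip i)) = i.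
  by rewrite flip_fillingE // cell_ofK ?block_flipK //; lia.
have t1 : tau (cell (flip i.+1)) = i.+1.
  by rewrite flip_fillingE // cell_ofK ?block_flipK //; lia.
have S1 : South (cell (flip i.+1)) = cell (flip i) by rewrite c1 NorthK.
apply/hasP; exists (cell (flip i.+1)); rewrite ?S1 ?t0 //.
by rewrite mem_Des d1 S1 t0 t1 c1 /= ltnSn.
Qed.

End DecreasingStandard.

(** * Standardization *)

(** Entries are compared first, and ties are broken by reading order. *)
Definition cell_le (T : assignment) (u v : cell) : bool :=
  (T u < T v) || (T u == T v) && ((v.1 < u.1) || (u.1 == v.1) && (u.2 <= v.2)).

Lemma cell_le_total T : total (cell_le T).
Proof. by move=> [r c] [r' c']; rewrite /cell_le /=; lia. Qed.

Lemma cell_le_trans T : transitive (cell_le T).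
Proof. by move=> [r c] [r' c'] [r'' c'']; rewrite /cell_le /=; lia. Qed.

Lemma cell_le_anti T : antisymmetric (cell_le T).
Proof.
move=> [r c] [r' c']; rewrite /cell_le /= => h.
by have [-> ->] : r = r' /\ c = c' by lia.
Qed.

Lemma attack_sym (u v : cell) : attack u v = attack v u.
Proof. by case: u v => [r c] [r' c']; rewrite /attack /=; lia. Qed.

Lemma nth_sorted_leq s i j : sorted leq s -> i <= j -> j < size s ->
  nth 0 s i <= nth 0 s j.
Proof.
move=> ss ij hj; apply: (sorted_leq_nth leq_trans leqnn 0 ss) => //.
by rewrite inE (leq_ltn_trans ij).
Qed.

Section Standardization.

Variable alpha : seq nat.
Local Notation dga := (dg alpha).
Local Notation n := (size dga).

(** An entry of a standard filling is its rank, so the relative order of the entries determines the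
    filling. *)
Lemma standard_count tau (u : cell) : standard alpha tau -> u \in dga ->
  tau u = count (fun v => tau v <= tau u) dga.
Proof.
move=> std hu; have hb := standard_bound std hu.
rewrite -(count_map tau (fun k => k <= tau u)) (permP std.2).
have -> : n = tau u + (n - tau u) by lia.
rewrite iotaD count_cat [X in X + _](_ : _ = tau u).
  rewrite [X in _ + X](_ : _ = 0) ?addn0 //.
  apply/eqP; rewrite -leqn0 leqNgt -has_count; apply/negP => /hasP[k].
  by rewrite mem_iota; lia.
rewrite -[RHS](size_iota 1); apply/eqP; rewrite -all_count; apply/allP => k.
by rewrite mem_iota; lia.
Qed.

Lemma eq_standard sigma tau : standard alpha sigma -> standard alpha tau ->
  {in dga &, forall u v, (sigma u <= sigma v) = (tau u <= tau v)} ->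
  sigma = tau.
Proof.
move=> s1 s2 e; apply: (eq_filling s1.1 s2.1) => u hu.
rewrite (standard_count s1) // (standard_count s2) //.
by apply: eq_in_count => v hv; apply: e.
Qed.

Variable T : assignment.

Definition standardization : assignment :=
  mk_filling alpha (fun u => (index u (sort (cell_le T) dga)).+1).

Let L := sort (cell_le T) dga.

Let mem_L u : (u \in L) = (u \in dga).
Proof. by rewrite mem_sort. Qed.

Let L_uniq : uniq L.
Proof. by rewrite sort_uniq dg_uniq. Qed.

Let L_size : size L = n.
Proof. by rewrite size_sort. Qed.

Let L_sorted : sorted (cell_le T) L.
Proof. exact/sort_sorted/cell_le_total. Qed.

Lemma standardization_standard : standard alpha standardization.
Proof.
split; first exact: mk_filling_is_filling.
have -> : entries alpha standardization = [seq (index u L).+1 | u <- dga].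
  by apply/eq_in_map => u hu; rewrite mk_fillingE.
apply: (@perm_trans _ [seq (index u L).+1 | u <- L]).
  by apply: perm_map; rewrite perm_sym; apply/permPl/perm_sort.
suff -> : [seq (index u L).+1 | u <- L] = iota 1 n by [].
apply: (@eq_from_nth _ 0); rewrite size_map ?size_iota // => i hi.
by rewrite (nth_map (0, 0)) // index_uniq // nth_iota // -L_size.
Qed.

Lemma standardization_le : {in dga &, forall u v,
  (standardization u <= standardization v) = cell_le T u v}.
Proof.
move=> u v hu hv; rewrite !mk_fillingE // ltnS.
have le x y : x \in dga -> y \in dga -> index x L <= index y L -> cell_le T x y.
  move=> hx hy; apply: (sorted_leq_index (@cell_le_trans T)); rewrite ?mem_L //.
  by move=> z; have := cell_le_total T z z; rewrite orbb.
apply/idP/idP => [|h]; first exact: le.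
case: (leqP (index u L) (index v L)) => // hvu.
have e : u = v by apply: (@cell_le_anti T); rewrite h (le _ _ hv hu (ltnW hvu)).
by rewrite e ltnn in hvu.
Qed.

(** Listed along [cell_le T], the entries of T form a sorted rearrangement of s, hence s itself.
    Labels start at 1, positions in s at 0. *)
Lemma standardization_nth s : sorted leq s -> perm_eq (entries alpha T) s ->
  {in dga, forall u, nth 0 s (standardization u).-1 = T u}.
Proof.
move=> ss hp u hu; rewrite mk_fillingE //=.
have <- : [seq T u | u <- L] = s.
  apply: (sorted_eq leq_trans anti_leq) => //.
    rewrite sorted_map; apply: sub_sorted L_sorted => x y.
    by rewrite /cell_le /= => /orP[/ltnW //|/andP[/eqP -> _]].
  by rewrite -(permPr hp); apply/perm_map/permPl/perm_sort.
by rewrite (nth_map (0, 0)) ?nth_index ?index_mem ?mem_L.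
Qed.

Hypothesis T_na : nonattacking alpha T.
Hypothesis T_dec : decreasing alpha T.
Local Notation sigma := standardization.
Local Notation cell := (cell_of alpha sigma).
Let std := standardization_standard.

(** On a tie within a column the upper cell is read first and gets the smaller label. *)
Lemma standardization_decreasing : decreasing alpha sigma.
Proof.
move=> [r c] hu; have := T_dec hu; move: hu; rewrite mem_dghat => /andP[/= u0 hu].
rewrite standardization_le ?South_dg // /cell_le /South /= => h; lia.
Qed.

(** Cells of the bottom row attack each other, so T has no ties there. *)
Lemma standardization_bottom_row (gamma : seq nat) :
  (forall c, c < size gamma -> (0, c) \in dga) ->
  bottom_row_like_beta gamma sigma <-> bottom_row_like_beta gamma T.
Proof.
move=> gamma_dg.
have e (i j : 'I_(size gamma)) :
    (sigma (0, val i) < sigma (0, val j)) = (T (0, val i) < T (0, val j)).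
  have hd (k : 'I_(size gamma)) : (0, val k) \in dga by apply/gamma_dg/ltn_ord.
  have [->|ij] := eqVneq i j; first by rewrite !ltnn.
  have ne : T (0, val i) != T (0, val j).
    by apply/eqP; apply: T_na; rewrite ?hd // /attack /= (inj_eq val_inj) ij.
  rewrite ltnNge standardization_le ?hd // /cell_le; move: ne => /=.
  by move: (T (0, _)) (T (0, _)) => a b; lia.
by split=> hb i j; rewrite -hb e.
Qed.

(** An arm cell of x attacks both x and [South x], in type A as in type B. *)
Lemma arm_cells_neq (x z : Defs.cell) : x \in dghat alpha ->
  z \in arm_cells alpha x -> T z != T x /\ T z != T (South x).
Proof.
rewrite mem_dghat => /andP[x0 hx] hz; have [hzd _] := arm_cells_column hz.
have hy := South_dg hx; move: hz; rewrite mem_filter => /andP[h _].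
split; apply/eqP; apply: T_na => //; move: h x0; clear;
  by case: x z => [r c] [r' c'] /=; rewrite /attack /=; lia.
Qed.

(** In a triple only x and [South x] can tie. Then T has no coinversion there, and neither has
    [sigma], where x gets the smaller label and z lies on one side of both. *)
Lemma standardization_coinv : coinv alpha sigma = coinv alpha T.
Proof.
apply: eq_big_seq => x hx; apply: eq_in_count => z hz.
have [n1 n2] := arm_cells_neq hx hz; have := T_dec hx.
have [hzd _] := arm_cells_column hz; move: hx; rewrite mem_dghat => /andP[x0 hx].
have hy := South_dg hx.
rewrite /coinv_triple !ltnNge !standardization_le // /cell_le /=.
by move: (South x) hy n2 => y hy n2; lia.
Qed.

Variable s : seq nat.
Hypothesis s_sorted : sorted leq s.
Hypothesis s_perm : perm_eq (entries alpha T) s.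
Let sT := standardization_nth s_sorted s_perm.

(** If the letters agree, the cells j and j+1 have equal entries in T: they are labelled in reading
    order, and they do not attack each other. *)
Lemma standardization_compatible j : 0 < j < n ->
  attack_or_ID alpha sigma j -> nth 0 s j.-1 <> nth 0 s j.
Proof.
move=> hj h.
have hu : cell j \in dga by apply: cell_of_dg => //; lia.
have hv : cell j.+1 \in dga by apply: cell_of_dg => //; lia.
have su : sigma (cell j) = j by rewrite cell_ofK //; lia.
have sv : sigma (cell j.+1) = j.+1 by rewrite cell_ofK //; lia.
have := sT hu; have := sT hv; rewrite su sv /= => -> ->.
have := standardization_le hu hv; rewrite su sv leqnSn /cell_le => /esym le.
have na := T_na hu hv.
case/orP: h => [|/na //]; rewrite /in_ID /reading_before.
by move: (cell j) (cell j.+1) le => [r c] [r' c'] /=; lia.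
Qed.

(* Equal entries lie in distinct rows, hence equal entries in vertically adjacent
   cells are consecutive in the standardization. *)
Lemma count_equal_South :
  count (fun u => T u == T (South u)) (dghat alpha) =
  count (fun i => same_column alpha sigma i && (nth 0 s i.-1 == nth 0 s i))
    (iota 1 n.-1).
Proof.
have dec := standardization_decreasing.
rewrite -!size_filter -(size_map sigma); apply: perm_size; apply: uniq_perm.
- rewrite map_inj_in_uniq ?filter_uniq ?dg_uniq // => u v.
  rewrite !mem_filter => /and3P[_ _ hu] /and3P[_ _ hv].
  exact: (standard_inj std).
- by rewrite filter_uniq ?iota_uniq.
move=> i; rewrite [RHS]mem_filter mem_iota; apply/mapP/andP.
  case=> u; rewrite mem_filter mem_dghat => /and3P[/eqP e u0 hu] ->.
  have hy := South_dg hu.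
  have lt : sigma u < sigma (South u).
    by rewrite ltnNge standardization_le // /cell_le /=; lia.
  have bu := standard_bound std hu; have by_ := standard_bound std hy.
  (* A cell labelled strictly between would have the same entry in T and be read between u and
     [South u]; it would share a row with one of them and attack it. *)
  have succ : sigma (South u) = (sigma u).+1.
    apply/eqP; rewrite eqn_leq lt andbT leqNgt; apply/negP => gap.
    set w := cell (sigma u).+1.
    have hw : w \in dga by apply: cell_of_dg => //; lia.
    have sw : sigma w = (sigma u).+1 by rewrite cell_ofK //; lia.
    have := standardization_le hu hw; have := standardization_le hw hy.
    have na1 := T_na hu hw; have na2 := T_na hw hy.
    rewrite sw leqnSn (ltnW gap) /cell_le => /esym h1 /esym h2.
    have w1 : w <> u by move=> wu; rewrite wu in sw; lia.
    have w2 : w <> South u by move=> wu; rewrite -wu sw in gap; lia.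
    move: u0 e w1 w2 h1 h2 na1 na2; rewrite /attack; clear.
    case: u w => [[//|r] c] [r' c'] /=.
    rewrite /South /= => _ e w1 w2 h1 h2 na1 na2.
    have [Te Te2 hr] :
        [/\ T (r.+1, c) = T (r', c'), T (r', c') = T (r, c) & r' = r.+1 \/ r' = r].
      move: e h1 h2; clear.
      move: (T (r.+1, c)) (T (r', c')) (T (r, c)) => a b d e h1 h2.
      by split; lia.
    case: hr => hr; subst r'.
      by have [cc|cc] := eqVneq c c'; [case: w1; rewrite cc|apply: na1; rewrite ?eqxx ?cc].
    by have [cc|cc] := eqVneq c' c; [case: w2; rewrite cc|apply: na2; rewrite ?eqxx ?cc].
  have := sT hu; have := sT hy; rewrite succ /= => -> ->; rewrite e eqxx.
  split; last by lia.
  by rewrite /same_column -succ !cell_of_val // eqxx.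
case=> /andP[sc /eqP e] hi.
have hi' : 0 < i < n by lia.
have := same_column_North std dec hi' sc => cN.
have hu : cell i \in dga by apply: cell_of_dg => //; lia.
have hv : cell i.+1 \in dga by apply: cell_of_dg => //; lia.
have su : sigma (cell i) = i by rewrite cell_ofK //; lia.
have sv : sigma (cell i.+1) = i.+1 by rewrite cell_ofK //; lia.
exists (cell i) => //; rewrite mem_filter mem_dghat hu {2}cN NorthK cN /= andbT.
by rewrite -cN -(sT hu) -(sT hv) su sv /= e.
Qed.

End Standardization.

(** * Destandardization *)

Section Destandardization.

Variables (alpha : seq nat) (sigma : assignment) (s : seq nat).
Local Notation dga := (dg alpha).
Local Notation n := (size dga).
Hypothesis std : standard alpha sigma.
Hypothesis dec : decreasing alpha sigma.
Hypothesis s_sorted : sorted leq s.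
Hypothesis s_size : size s = n.
Hypothesis s_gt0 : all (fun k => 0 < k) s.
Hypothesis s_compat : forall j, 0 < j < n -> attack_or_ID alpha sigma j ->
  nth 0 s j.-1 <> nth 0 s j.
Local Notation cell := (cell_of alpha sigma).

Definition destandardization : assignment :=
  mk_filling alpha (fun u => nth 0 s (sigma u).-1).
Local Notation T := destandardization.

Lemma destandardizationE (u : Defs.cell) : u \in dga -> T u = nth 0 s (sigma u).-1.
Proof. exact: mk_fillingE. Qed.

Lemma destandardization_filling : is_filling alpha T.
Proof.
apply: mk_filling_is_filling => u hu; apply: (allP s_gt0); apply: mem_nth.
by rewrite s_size; have := standard_bound std hu; lia.
Qed.

Lemma destandardization_perm : perm_eq (entries alpha T) s.
Proof.
have -> : entries alpha T = map (fun k => nth 0 s k.-1) (entries alpha sigma).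
  by rewrite /entries -map_comp; apply/eq_in_map => u hu; rewrite destandardizationE.
rewrite (perm_trans (perm_map _ std.2)) // (iotaDl 1 0) -map_comp /=.
by rewrite map_nth_iota0 ?s_size // -s_size take_size.
Qed.

Lemma destandardization_homo (u v : Defs.cell) : u \in dga -> v \in dga ->
  sigma u <= sigma v -> T u <= T v.
Proof.
move=> hu hv h; rewrite !destandardizationE //.
have hb := standard_bound std hv.
by apply: nth_sorted_leq => //; lia.
Qed.

Lemma destandardization_decreasing : decreasing alpha T.
Proof.
move=> u hu; have := dec hu; move: hu; rewrite mem_dghat => /andP[_ hu].
by apply: destandardization_homo; rewrite ?South_dg.
Qed.

(* Nonattacking is only assumed for consecutive entries; the rows of equal entries
   strictly decrease, so that nonconsecutive ones are at least two rows apart. *)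
Lemma row_drop i j : 0 < i -> i < j <= n -> nth 0 s i.-1 = nth 0 s j.-1 ->
  (cell j).1 + (j - i) <= (cell i).1.
Proof.
move=> i0; elim: j => // j IH hj e.
have mono a b : a <= b -> b < n -> nth 0 s a <= nth 0 s b.
  by move=> ab bn; apply: nth_sorted_leq => //; rewrite s_size.
(* A weakly increasing word with equal letters at both ends is constant in between. *)
have e1 : nth 0 s j.-1 = nth 0 s j.
  apply/eqP; rewrite eqn_leq mono ?leq_pred //=; last by lia.
  by rewrite -[nth 0 s j]e; apply: mono; lia.
(* As j+1 neither precedes j in reading order nor attacks it, it lies in a strictly lower row. *)
have : ~~ attack_or_ID alpha sigma j.
  by apply/negP => /s_compat h; apply: h => //; lia.
have ne : cell j <> cell j.+1 by move/(cell_of_inj std) => h; have := h _ _; lia.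
rewrite /attack_or_ID /in_ID /reading_before /attack.
have [ij|ij] := eqVneq i j.
  rewrite -ij in ne *; move: (cell i) (cell i.+1) ne => [r c] [r' c'] ne /=.
  have : r <> r' \/ c <> c'.
    by have [rr|rr] := eqVneq r r'; [right=> cc; case: ne; rewrite rr cc|left; apply/eqP].
  by lia.
have := IH _ _; rewrite e e1 => IH'.
have {IH'} : (cell j).1 + (j - i) <= (cell i).1 by apply: IH' => //; lia.
move: (cell i) (cell j) (cell j.+1) ne => [ri ci] [r c] [r' c'] ne /=.
have : r <> r' \/ c <> c'.
  by have [rr|rr] := eqVneq r r'; [right=> cc; case: ne; rewrite rr cc|left; apply/eqP].
by lia.
Qed.

Lemma destandardization_nonattacking : nonattacking alpha T.
Proof.
move=> u v hu hv; wlog uv : u v hu hv / sigma u <= sigma v.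
  move=> H h; case: (leqP (sigma u) (sigma v)) => [|/ltnW] le; first exact: H.
  by apply/nesym; apply: H => //; rewrite attack_sym.
move=> at_; rewrite !destandardizationE //.
have bu := standard_bound std hu; have bv := standard_bound std hv.
have ne : sigma u != sigma v.
  apply: contraTneq at_ => /(standard_inj std hu hv) ->.
  by case: (v) => r c; rewrite /attack /=; lia.
move=> e.
have := row_drop _ _ e; rewrite !cell_of_val // => row.
case: (ltngtP (sigma u).+1 (sigma v)) => [lt|lt|succ]; [|by lia|].
  have {row} : v.1 + (sigma v - sigma u) <= u.1 by apply: row; lia.
  by move: u v at_ lt {hu hv ne uv bu bv e} => [r c] [r' c']; rewrite /attack /=; lia.
have := s_compat (j := sigma u); rewrite succ => h; apply: h.
- by lia.
- by rewrite /attack_or_ID succ !cell_of_val // at_ orbT.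
- by rewrite e -succ.
Qed.

(** By [row_drop], equal entries are labelled from higher rows to lower ones, that is, in reading
    order. *)
Lemma destandardizationK : standardization alpha T = sigma.
Proof.
apply: (eq_standard (standardization_standard _ _) std) => u v hu hv.
rewrite standardization_le //.
have le x y : x \in dga -> y \in dga -> sigma x <= sigma y -> cell_le T x y.
  move=> hx hy; rewrite leq_eqVlt => /orP[/eqP /(standard_inj std hx hy) ->|xy].
    by have := cell_le_total T y y; rewrite orbb.
  have := destandardization_homo hx hy (ltnW xy).
  rewrite leq_eqVlt /cell_le => /orP[/eqP e|-> //].
  have bx := standard_bound std hx; have by_ := standard_bound std hy.
  rewrite e eqxx ltnn /=; move: e; rewrite !destandardizationE // => e.
  have := row_drop _ _ e; rewrite !cell_of_val // => row.
  have {row} : y.1 + (sigma y - sigma x) <= x.1 by apply: row; lia.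
  by move: xy; clear; case: x y => [r c] [r' c'] /=; lia.
apply/idP/idP => [h|]; last exact: le.
case: (leqP (sigma u) (sigma v)) => // vu.
have e : u = v by apply: (@cell_le_anti T); rewrite h (le _ _ hv hu (ltnW vu)).
by rewrite e ltnn in vu.
Qed.

End Destandardization.

(** * The weighted bijection *)

(** The power is expanded as a product over all i, with x replaced by 0 outside E, so that only
    subsets of E survive. *)
Lemma sum_subset_exp (R : comRingType) (I : finType) (E : {set I}) (x : R) :
  (\sum_(A in powerset E) x ^+ #|A| = (1 + x) ^+ #|E|)%R.
Proof.
transitivity (\sum_(A in {set I}) \prod_i
    (if i \in A then (if i \in E then x else 0) else 1))%R.
  rewrite big_mkcond; apply: eq_bigr => A _; rewrite powersetE.
  case: ifP => [sub|/negbT/fintype.subsetPn[i iA iE]].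
    rewrite -big_mkcond -prodr_const; apply: eq_bigr => i iA.
    by rewrite (fintype.subsetP sub).
  by rewrite (bigD1 i) //= iA (negPf iE) mul0r.
rewrite -(bigA_distr 1%R +%R (fun i => if i \in E then x else 0%R) (fun=> 1%R)).
rewrite -prodr_const [RHS]big_mkcond; apply: eq_bigr => i _.
by case: ifP => _; [apply: addrC|apply: add0r].
Qed.

Lemma card_ord_set m (P : pred nat) :
  #|[set i : 'I_m | P i]| = count P (iota 0 m).
Proof.
rewrite -sum1_card -sum1_count -val_enum_ord big_map big_enum_cond /=.
by apply: eq_bigl => i; rewrite inE.
Qed.

Section Bijection.

Variables (gamma s : seq nat).
Local Notation alpha := (inc gamma).
Local Notation dga := (dg alpha).
Local Notation n := (size dga).
Hypothesis hgamma : strong_composition gamma.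
Hypothesis s_sorted : sorted leq s.
Hypothesis s_size : size s = n.
Hypothesis s_gt0 : all (fun k => 0 < k) s.

Lemma size_dg_inc : n = sumn gamma.
Proof. by rewrite size_dg; apply/perm_sumn/permPl/perm_sort. Qed.

Lemma bottom_row_dg c : c < size gamma -> (0, c) \in dga.
Proof.
move=> hc; rewrite mem_dg /=; have hc' : c < size alpha by rewrite size_sort.
by have := mem_nth 0 hc'; rewrite mem_sort => /(allP hgamma).
Qed.

Lemma ST_standard tau :
  ST gamma tau <-> standard alpha tau /\ bottom_row_like_beta gamma tau.
Proof.
by rewrite /standard size_dg_inc; split=> [[]|[[]]].
Qed.

Definition set_pred (A : {set 'I_n}) : pred nat :=
  fun i => i \in [seq val j | j in A].

Lemma set_predE (A : {set 'I_n}) (i : 'I_n) : set_pred A i = (i \in A).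
Proof.
by rewrite /set_pred mem_map ?mem_enum //; apply: val_inj.
Qed.

Lemma count_set_pred (A : {set 'I_n}) : count (set_pred A) (iota 0 n) = #|A|.
Proof.
rewrite -card_ord_set; congr #|pred_of_set _|.
by apply/setP => i; rewrite inE set_predE.
Qed.

(** The fillings that contribute at q = 0 to the coefficient of the monomial with sorted word s. *)
Definition base_filling (T : assignment) : Prop :=
  [/\ NAT gamma T, decreasing alpha T & perm_eq (entries alpha T) s].

(** Says that the monomial of s occurs in the fundamental function of [Vhat gamma tau]. *)
Definition compatible (tau : assignment) : Prop :=
  forall j, 1 <= j < sumn gamma -> Vhat gamma tau j ->
  nth 0 s j.-1 <> nth 0 s j.

(** The admissible sets D are the subsets of this set. The letters of the labels i and i+1 are at
    positions [i.-1] and [i] of s. *)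
Definition strict_columns (T : assignment) : {set 'I_n} :=
  [set i : 'I_n | [&& 0 < i, same_column alpha (standardization alpha T) i
                    & nth 0 s i.-1 != nth 0 s i]].

Definition raise (T : assignment) (A : {set 'I_n}) : assignment :=
  flip_filling alpha (set_pred A) (standardization alpha T).

(** * The standard filling raised from a base filling *)

Section Raise.

Variables (T : assignment) (A : {set 'I_n}).
Hypothesis T_base : base_filling T.
Hypothesis A_sub : A \subset strict_columns T.
Local Notation sigma := (standardization alpha T).
Local Notation tau := (raise T A).

Let T_na : nonattacking alpha T. Proof. by case: T_base => [[]]. Qed.
Let T_dec : decreasing alpha T. Proof. by case: T_base. Qed.
Let T_perm : perm_eq (entries alpha T) s. Proof. by case: T_base. Qed.
Let std := standardization_standard alpha T.
Let dec := standardization_decreasing T_dec.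

Lemma set_pred_strict i : set_pred A i ->
  [/\ 0 < i < n, same_column alpha sigma i & nth 0 s i.-1 <> nth 0 s i].
Proof.
case/mapP=> j; rewrite mem_enum => /(fintype.subsetP A_sub).
by rewrite inE => /and3P[j0 hc /eqP hs] ->; rewrite j0 ltn_ord.
Qed.

Let Ab i : set_pred A i -> 0 < i < n. Proof. by case/set_pred_strict. Qed.
Let Acol i : set_pred A i -> same_column alpha sigma i.
Proof. by case/set_pred_strict. Qed.

Lemma raise_standard : standard alpha tau.
Proof. exact: flip_filling_standard. Qed.

Lemma raise_unit_descents (u : cell) :
  u \in Des alpha tau -> tau u = (tau (South u)).+1.
Proof. by case/(flip_Des std dec Ab Acol). Qed.

Lemma raise_descent_floor : descent_floor alpha tau = set_pred A.
Proof. exact/funext/(flip_descent_floor std dec Ab Acol). Qed.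

Lemma flip_raise : flip_filling alpha (descent_floor alpha tau) tau = sigma.
Proof. by rewrite raise_descent_floor (flip_fillingK std Ab). Qed.

Lemma raise_ST1 : ST1 gamma tau.
Proof.
split; last exact: raise_unit_descents.
apply/ST_standard; split; first exact: raise_standard.
apply: (bottom_row_flip std bottom_row_dg).
  exact: (fall_block_column std dec Ab Acol).
by apply/(standardization_bottom_row T_na bottom_row_dg); case: T_base => [[]].
Qed.

(** By [Vhat_flip], j lies in A, where letters are strict by the choice of A, or comes from [sigma],
    where they are strict because T is nonattacking. *)
Lemma raise_compatible : compatible tau.
Proof.
move=> j hj [_ hV]; have hj' : 0 < j < n by rewrite size_dg_inc.
have := (Vhat_flip raise_standard raise_unit_descents hj').1 hV.
rewrite flip_raise raise_descent_floor => -[/set_pred_strict[] //|].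
exact: standardization_compatible.
Qed.

Lemma raise_size_Des : size (Des alpha tau) = #|A|.
Proof.
rewrite -count_set_pred -raise_descent_floor -size_filter.
rewrite -(perm_size (perm_descent_floor raise_standard raise_unit_descents)).
by rewrite size_map.
Qed.

Lemma raise_coinv : coinv alpha tau = coinvDes alpha tau + coinv alpha T.
Proof.
rewrite (coinv_flip raise_standard raise_unit_descents) flip_raise.
by rewrite (standardization_coinv T_na T_dec).
Qed.

(** The i with i and i+1 in one column split by whether their letters agree: those with equal
    letters count the cells of T equal to the cell below, the others form [strict_columns T]. *)
Lemma raise_omega :
  (omega gamma tau + #|strict_columns T|%:Z =
   (count (fun u => T u != T (South u)) (dghat alpha))%:Z)%R.
Proof.
have : count (fun u => T u == T (South u)) (dghat alpha) +
    count (fun u => T u != T (South u)) (dghat alpha) = size (dghat alpha).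
  exact: count_predC.
rewrite (count_equal_South T_na T_dec s_sorted T_perm) /omega.
rewrite (eq_in_count (a1 := fun i => (cell_of _ tau i).2 == _)
  (a2 := same_column alpha sigma)); last first.
  move=> i; rewrite mem_iota -size_dg_inc => hi.
  rewrite -[LHS](same_column_flip raise_standard raise_unit_descents) ?flip_raise //.
  by lia.
have -> : #|strict_columns T| =
    count (fun i => same_column alpha sigma i && (nth 0 s i.-1 != nth 0 s i))
      (iota 1 n.-1).
  rewrite (card_ord_set n (fun i => [&& 0 < i, same_column alpha sigma i
    & nth 0 s i.-1 != nth 0 s i])).
  case: n => //= k; rewrite add0n; apply: eq_in_count => i.
  by rewrite mem_iota => /andP[-> _].
have := count_predC (fun i => nth 0 s i.-1 == nth 0 s i)
  [seq i <- iota 1 n.-1 | same_column alpha sigma i].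
rewrite !count_filter size_filter -size_dg_inc.
rewrite (eq_count (a1 := predI _ (same_column _ _))
  (a2 := fun i => same_column alpha sigma i && (nth 0 s i.-1 == nth 0 s i))); last first.
  by move=> i /=; rewrite andbC.
rewrite (eq_count (a1 := predI (predC _) (same_column _ _))
  (a2 := fun i => same_column alpha sigma i && (nth 0 s i.-1 != nth 0 s i))); last first.
  by move=> i /=; rewrite andbC.
rewrite -[count (fun i => same_column _ _ i) _]/
  (count (same_column alpha sigma) (iota 1 n.-1)).
move: (count _ _) (count _ _) (count _ _) (count _ _) (size (dghat alpha)) => a b c d e.
by lia.
Qed.

End Raise.

(** A is the [descent_floor] of the raised filling, flipping along it gives back the
    standardization, and reading s through that gives back T. *)
Lemma raise_inj T T' (A A' : {set 'I_n}) : base_filling T -> base_filling T' ->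
  A \subset strict_columns T -> A' \subset strict_columns T' ->
  raise T A = raise T' A' -> T = T' /\ A = A'.
Proof.
move=> bT bT' sA sA' e; split.
  have es : standardization alpha T = standardization alpha T'.
    by rewrite -(flip_raise bT sA) -(flip_raise bT' sA') e.
  case: bT bT' => [[fT _ _] _ pT] [[fT' _ _] _ pT'].
  apply: (eq_filling fT fT') => u hu.
  by rewrite -(standardization_nth s_sorted pT) // es (standardization_nth s_sorted pT').
apply/setP => i; rewrite -!set_predE.
by rewrite -(raise_descent_floor bT sA) -(raise_descent_floor bT' sA') e.
Qed.

(** Flip tau along its [descent_floor] D and read s through the result. Compatibility makes the
    letters strict on D, so D is admissible, and makes the filling nonattacking. *)
Lemma raise_surj tau : ST1 gamma tau -> compatible tau ->
  exists T (A : {set 'I_n}),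
    [/\ base_filling T, A \subset strict_columns T & tau = raise T A].
Proof.
case=> /ST_standard[std hb] ud compat.
pose D := descent_floor alpha tau; pose sigma := flip_filling alpha D tau.
have Db := descent_floor_bound std ud.
have sstd : standard alpha sigma := flip_filling_standard std Db.
have dec : decreasing alpha sigma := flip_filling_decreasing std ud.
have hV j : 0 < j < n -> D j \/ attack_or_ID alpha sigma j -> nth 0 s j.-1 <> nth 0 s j.
  move=> hj h; apply: compat; first by rewrite -size_dg_inc.
  split; first by rewrite -size_dg_inc.
  exact: (Vhat_flip std ud hj).2.
have s_compat j (hj : 0 < j < n) (h : attack_or_ID alpha sigma j) := hV j hj (or_intror h).
have sK := destandardizationK sstd s_sorted s_size s_gt0 s_compat.
have na := destandardization_nonattacking sstd s_sorted s_size s_gt0 s_compat.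
exists (destandardization alpha sigma s), [set i : 'I_n | D i].
have AD : set_pred [set i : 'I_n | D i] = D.
  apply/funext => i; apply/idP/idP => [/mapP[j]|Di].
    by rewrite mem_enum inE => Dj ->.
  have hi : i < n by have := Db _ Di; lia.
  by have := set_predE [set i : 'I_n | D i] (Ordinal hi); rewrite inE /= Di => ->.
split; last by rewrite /raise sK AD (flip_fillingK std Db).
  split; last exact: destandardization_perm.
    split=> //; first exact: destandardization_filling.
    apply/(standardization_bottom_row na bottom_row_dg); rewrite sK.
    apply: (bottom_row_flip std bottom_row_dg) hb => i j e.
    by have [] := block_cells std ud e.
  exact: destandardization_decreasing.
apply/fintype.subsetP => i; rewrite !inE sK => Di; have hi := Db _ Di.
rewrite (descent_floor_same_column std ud Di) /=.
apply/andP; split; first by lia.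
by apply/eqP; apply: hV => //; left.
Qed.

(** * Summation of the weights over the admissible sets *)

Section Sum.

Local Open Scope ring_scope.

Variables (K : fieldType) (t : K).
Hypothesis t_neq1 : 1 - t != 0.

(** Only [(- t) ^+ #|A|] varies with A; its sum, 1 - t to the size of [strict_columns T], makes up
    for the size subtracted in the exponent [omega]. Adding integer exponents requires 1 - t to be
    nonzero. *)
Lemma sum_raise_weights T : base_filling T ->
  \sum_(A in powerset (strict_columns T))
     (1 - t) ^ omega gamma (raise T A) * (- t) ^+ size (Des alpha (raise T A))
     * t ^ ((coinv alpha (raise T A))%:Z - (coinvDes alpha (raise T A))%:Z) =
  t ^+ coinv alpha T * (1 - t) ^+ count (fun u => T u != T (South u)) (dghat alpha).
Proof.
move=> bT; set m := count _ _.
transitivity (\sum_(A in powerset (strict_columns T))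
  (1 - t) ^ (m%:Z - #|strict_columns T|%:Z) * t ^+ coinv alpha T * (- t) ^+ #|A|).
  apply: eq_bigr => A; rewrite powersetE => sA.
  rewrite (raise_size_Des bT sA) (raise_coinv bT sA) PoszD addrAC subrr add0r.
  by rewrite /m -(raise_omega bT sA) addrK -!mulrA; congr (_ * _); rewrite mulrC.
rewrite -mulr_sumr sum_subset_exp mulrAC [X in _ * X * _]exprnP -expfzDr //.
by rewrite subrK mulrC.
Qed.

(** [raise] matches X with the pairs of a T in N and a subset of [strict_columns T]. *)
Lemma sum_base_fillings (N X : seq assignment) : uniq N -> uniq X ->
  (forall T, T \in N <-> base_filling T) ->
  (forall tau, tau \in X <-> ST1 gamma tau /\ compatible tau) ->
  \sum_(T <- N) t ^+ coinv alpha T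
     * (1 - t) ^+ count (fun u => T u != T (South u)) (dghat alpha) =
  \sum_(tau <- X) (1 - t) ^ omega gamma tau * (- t) ^+ size (Des alpha tau)
     * t ^ ((coinv alpha tau)%:Z - (coinvDes alpha tau)%:Z).
Proof.
move=> uN uX memN memX.
have pX : perm_eq X
    [seq raise T A | T <- N, A <- enum (powerset (strict_columns T))].
  apply: uniq_perm => //.
    apply: allpairs_uniq_dep => // [T _|]; first exact: enum_uniq.
    move=> _ _ /allpairsPdep[T [A [hT hA ->]]] /allpairsPdep[T' [A' [hT' hA' ->]]] /=.
    move: hA hA'; rewrite !mem_enum !powersetE => hA hA'.
    by case/(raise_inj ((memN _).1 hT) ((memN _).1 hT') hA hA') => -> ->.
  move=> tau; apply/idP/allpairsPdep => [/memX[h1 h2]|[T [A [/memN hT + ->]]]].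
    have [T [A [bT sA ->]]] := raise_surj h1 h2.
    by exists T, A; rewrite mem_enum powersetE; split=> //; apply/memN.
  rewrite mem_enum powersetE => sA; apply/memX.
  by split; [exact: raise_ST1|exact: raise_compatible].
rewrite (perm_big _ pX) big_allpairs_dep /=.
apply: eq_big_seq => T /memN bT.
by rewrite -(sum_raise_weights bT) big_enum.
Qed.

End Sum.

End Bijection.

(** * Specialization at q = 0 *)

Section ValueAtZero.

Local Open Scope ring_scope.

Variable K : fieldType.
Implicit Types (f g : {fraction {poly K}}) (v w : K) (p : {poly K}).

(** f is regular at 0 with value v. A relation is used since [spec0] respects sums and products only
    away from poles at 0. *)
Definition has_value0 f v : Prop :=
  exists p d : {poly K}, [/\ d.[0] != 0, f = tofrac p / tofrac d & v = p.[0] / d.[0]].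

Lemma spec0E f v : has_value0 f v -> spec0 f = v.
Proof. by case=> p [d [d0 -> ->]]; apply: spec0_div. Qed.

Lemma tofrac_neq0 p : p.[0] != 0 -> tofrac p != 0.
Proof. by rewrite tofrac_eq0; apply: contraNneq => ->; rewrite horner0. Qed.

Lemma has_value0_poly p : has_value0 (tofrac p) p.[0].
Proof. by exists p, 1; rewrite hornerC oner_neq0 tofrac1 !divr1. Qed.

Lemma has_value0D f g v w :
  has_value0 f v -> has_value0 g w -> has_value0 (f + g) (v + w).
Proof.
case=> p [d [d0 -> ->]] [p' [d' [d'0 -> ->]]].
exists (p * d' + p' * d), (d * d'); split; first by rewrite hornerM mulf_neq0.
  by rewrite addf_div ?tofrac_neq0 // tofracD !tofracM.
by rewrite addf_div // !hornerE.
Qed.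

Lemma has_value0M f g v w :
  has_value0 f v -> has_value0 g w -> has_value0 (f * g) (v * w).
Proof.
case=> p [d [d0 -> ->]] [p' [d' [d'0 -> ->]]].
exists (p * p'), (d * d'); split; first by rewrite hornerM mulf_neq0.
  by rewrite mulf_div !tofracM.
by rewrite mulf_div !hornerE.
Qed.

Lemma has_value0V f v : v != 0 -> has_value0 f v -> has_value0 f^-1 v^-1.
Proof.
move=> v0 [p [d [d0 fE vE]]]; exists d, p; split.
- by apply: contraNneq v0 => p0; rewrite vE p0 mul0r.
- by rewrite fE invf_div.
- by rewrite vE invf_div.
Qed.

Lemma has_value0X f v k : has_value0 f v -> has_value0 (f ^+ k) (v ^+ k).
Proof.
move=> fv; elim: k => [|k IH]; last by rewrite !exprS; apply: has_value0M.
by have := has_value0_poly 1; rewrite tofrac1 hornerC.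
Qed.

Lemma has_value0_prod (I : Type) (r : seq I) (P : pred I) F v :
  (forall i, P i -> has_value0 (F i) v) ->
  has_value0 (\prod_(i <- r | P i) F i) (v ^+ count P r).
Proof.
move=> FP; elim: r => [|i r IH]; rewrite ?big_nil ?big_cons /=.
  by have := has_value0_poly 1; rewrite tofrac1 hornerC.
by case: ifP => // Pi; rewrite exprS; apply: has_value0M => //; apply: FP.
Qed.

Lemma has_value0_sum (I : Type) (r : seq I) F (V : I -> K) :
  (forall i, has_value0 (F i) (V i)) ->
  has_value0 (\sum_(i <- r) F i) (\sum_(i <- r) V i).
Proof.
move=> FV; apply: (big_ind2 has_value0) => //.
  by have := has_value0_poly 0; rewrite tofrac0 hornerC.
by move=> *; apply: has_value0D.
Qed.

End ValueAtZero.

Local Open Scope ring_scope.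

Lemma tvar_neq1 : 1 - tvar != 0.
Proof.
rewrite subr_eq0 /tvar -tofrac1 tofrac_eq; apply/eqP => /(congr1 (fun p => p.[0])).
by rewrite hornerX hornerC => /eqP; rewrite oner_eq0.
Qed.

(** Each descent adds at least 1 to [maj], so the power of q vanishes at 0 unless there is none.
    Each denominator has value 1, its exponent of q being positive. *)
Lemma wt_value0 alpha (T : assignment) :
  has_value0 (wt q_qt t_qt alpha T)
    (if Des alpha T == [::] then
       tvar ^+ coinv alpha T
       * (1 - tvar) ^+ count (fun u => T u != T (South u)) (dghat alpha)
     else 0).
Proof.
have qv : has_value0 q_qt 0 by have := has_value0_poly ('X : {poly Qt}); rewrite hornerX.
have tv : has_value0 t_qt tvar by have := has_value0_poly (tvar%:P); rewrite hornerC.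
have v1 : has_value0 1 (1 : Qt).
  by have := has_value0_poly (1 : {poly Qt}); rewrite tofrac1 hornerC.
have vN f v : has_value0 f v -> has_value0 (- f) (- v : Qt).
  move=> fv; rewrite -[- f]mulN1r -[- v]mulN1r; apply: has_value0M => //.
  by have := has_value0_poly (- 1 : {poly Qt}); rewrite tofracN tofrac1 hornerN hornerC.
set c := count _ _.
have -> : (if Des alpha T == [::] then tvar ^+ coinv alpha T * (1 - tvar) ^+ c else 0) =
    0 ^+ maj alpha T * tvar ^+ coinv alpha T * (1 - tvar) ^+ c.
  rewrite expr0n /maj; case: (Des alpha T) => [|u l]; first by rewrite big_nil mul1r.
  by rewrite big_cons addn1 addSn /= !mul0r.
apply: has_value0M; first by apply: has_value0M; apply: has_value0X.
apply: has_value0_prod => u _; rewrite -[1 - tvar]divr1.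
apply: has_value0M; first by apply: has_value0D => //; apply: vN.
apply: has_value0V; first exact: oner_neq0.
rewrite -[X in has_value0 _ X]subr0; apply: has_value0D => //; apply: vN.
rewrite -[X in has_value0 _ X](mul0r (tvar ^+ (arm alpha u + 1))).
apply: has_value0M; last exact: has_value0X.
by have := has_value0X (leg alpha u + 1) qv; rewrite addn1 expr0n.
Qed.

(** * Extraction of coefficients *)

Lemma finite_fillings alpha (w : seq nat) :
  finite_set [set T | is_filling alpha T /\ perm_eq (entries alpha T) w]%classic.
Proof.
(* A filling is recovered from its list of entries along [dg alpha], one of the finitely many
   rearrangements of w. *)
pose F v := mk_filling alpha (fun u => nth 0%N v (index u (dg alpha))).
apply: (sub_finite_set _ (finite_seq (map F (permutations w)))) => T [fT pT] /=.
apply/mapP; exists (entries alpha T); first by rewrite mem_permutations.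
have TE u : u \in dg alpha -> T u = nth 0%N (entries alpha T) (index u (dg alpha)).
  by move=> hu; rewrite (nth_map (0, 0)%N) ?index_mem // nth_index.
apply: (eq_filling fT) => [|u hu]; last by rewrite mk_fillingE -?TE.
by apply: mk_filling_is_filling => u hu; rewrite -TE // (filling_gt0 fT).
Qed.

Lemma xmonE alpha T (m : {mset nat}%mset) :
  xmon alpha T = m <-> perm_eq (entries alpha T) (sort leq m).
Proof.
rewrite perm_sym perm_sort perm_sym -{1}(seq_mset_id m).
by split=> [/eq_seq_msetP|/eq_seq_msetP].
Qed.

(** A multiset has a single weakly increasing arrangement, so the coefficient is 1 or 0. *)
Lemma fundamentalE (R : pzSemiRingType) k (S : set nat) (m : {mset nat}%mset) :
  let s := sort leq m in
  fundamental R k S m =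
  (`[< [/\ size s = k, all (fun i => (0 < i)%N) s
         & forall j, (1 <= j < k)%N -> S j -> nth 0%N s j.-1 <> nth 0%N s j] >])%:R.
Proof.
move=> s; rewrite /fundamental /formal_sum; set B := [set _ | _]%classic.
have BE (u : k.-tuple nat) : B u -> tval u = s.
  case=> -[_ su _] um; apply: (sorted_eq leq_trans anti_leq) => //.
    exact/sort_sorted/leq_total.
  rewrite perm_sym perm_sort perm_sym.
  by apply/eq_seq_msetP; rewrite um seq_mset_id.
case: asboolP => [[ss s0 sS]|h].
  have -> : B = [set tcast ss (in_tuple s)]%classic; last by rewrite fsbig_set1.
  apply/seteqP; split=> [u /BE us|_ ->].
    by apply: val_inj; apply: etrans us _; rewrite -[RHS]/(tval _) val_tcast.
  rewrite /B /= val_tcast; split.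
    by split=> //; apply/sort_sorted/leq_total.
  rewrite -[RHS]seq_mset_id; apply/eq_seq_msetP.
  exact/permPl/perm_sort.
have -> : B = set0; last by rewrite fsbig_set0.
apply/seteqP; split=> // u Bu; have us := BE u Bu; case: Bu => -[u0 _ uS] _.
by case: h; rewrite -us; split=> //; rewrite size_tuple.
Qed.

Theorem theorem1p2 (gamma : seq nat) (hgamma : strong_composition gamma) :
  Gq0 gamma =
  (fun m => \sum_(tau \in ST1 gamma)
     (1 - tvar) ^ omega gamma tau
     * (- tvar) ^+ size (Des (inc gamma) tau)
     * tvar ^ ((coinv (inc gamma) tau)%:Z - (coinvDes (inc gamma) tau)%:Z)
     * fundamental Qt (sumn gamma) (Vhat gamma tau) m).
Proof.
apply/funext => m; pose s := sort leq m; pose alpha := inc gamma.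
have s_sorted : sorted leq s by apply/sort_sorted/leq_total.
rewrite /Gq0 /G /Gpar /formal_sum; set A := [set _ | _]%classic.
have AE T : A T <-> NAT gamma T /\ perm_eq (entries alpha T) s.
  by rewrite /A /=; split=> -[hT /xmonE].
have Afin : finite_set A.
  apply: (sub_finite_set _ (finite_fillings alpha s)) => T /AE[[fT _ _] pT].
  by split.
have ST1fin : finite_set (ST1 gamma).
  apply: (sub_finite_set _ (finite_fillings alpha (iota 1 (sumn gamma)))).
  by move=> tau [[fT pT _] _]; split.
(* A monomial of the wrong degree, or involving the index 0, has coefficient 0 on both sides. *)
have [[s_size s_gt0]|s_bad] :=
  pselect (size s = sumn gamma /\ all (fun i => (0 < i)%N) s); last first.
  have -> : A = set0.
    apply/seteqP; split=> // T /AE[[fT _ _] pT]; case: s_bad; split.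
      by rewrite -(perm_size pT) size_map size_dg_inc.
    by rewrite -(perm_all _ pT); apply/allP => _ /mapP[u hu ->]; apply: filling_gt0 hu.
  rewrite fsbig_set0 (spec0E (v := 0)); last first.
    by have := has_value0_poly (0 : {poly Qt}); rewrite tofrac0 hornerC.
  rewrite fsbig1 // => tau _; rewrite fundamentalE asboolF ?mulr0 //.
  by case=> ? ? _; apply: s_bad.
rewrite (fsbig_finite _ _ Afin) (fsbig_finite _ _ ST1fin) /=.
(* The value at q = 0 restricts the left sum to the fillings without descents; the coefficient of
   the fundamental function then restricts the right sum to the compatible ones. *)
rewrite (spec0E (has_value0_sum _ (wt_value0 alpha))) -big_mkcond /=.
under [RHS]eq_bigr => tau _.
  rewrite fundamentalE (_ : [/\ _, _ & _] = compatible gamma s tau); last first.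
    by apply/propext; split=> [[]|].
  rewrite mulr_natr mulrb; over.
rewrite -big_mkcond /= -big_filter -[RHS]big_filter.
rewrite -size_dg_inc in s_size.
apply: (sum_base_fillings hgamma s_sorted s_size s_gt0 tvar_neq1).
- exact/filter_uniq/fset_uniq.
- exact/filter_uniq/fset_uniq.
- move=> T; rewrite mem_filter in_fset_set //.
  split=> [/andP[/eqP /decreasingP dT /set_mem /AE[nT pT]]|]; first by split.
  by case=> nT /decreasingP -> pT; rewrite eqxx; apply/mem_set/AE.
- move=> tau; rewrite mem_filter in_fset_set //.
  split=> [/andP[/asboolP h /set_mem]|[h /asboolP ->]]; first by split.
  exact/mem_set.
Qed.
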